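(* Let $G$ be a finite, simple, connected graph of order $n$ with minimum degree $\delta(G)$ such that $n\leq 3\delta(G)$. If $L(G)\leq 2\delta(G)-1$, then $c(G)\geq n-1$.
   Context: All graphs are finite, simple and nontrivial (at least two vertices). For a connected graph $G$, the leaf number $L(G)$ is the maximum number of leaves (vertices of degree $1$) over all spanning trees of $G$. $\delta(G)$ denotes the minimum degree of $G$, and $c(G)$ denotes the number of vertices of a longest cycle in $G$ (the circumference). *)

(* Defs.v *)
From mathcomp Require Import all_boot.

Set Implicit Arguments.
Unset Strict Implicit.
Unset Printing Implicit Defensive.

(* A finite simple graph is a symmetric irreflexive relation e on a finType V. *)
Section Graphs.
Variable V : finType.
Implicit Types (e : rel V) (t : {set V * V}).

Definition degree e (x : V) : nat := #|[set y | e x y]|.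

(* Every degree of a simple graph is smaller than #|V|, so the default value
   #|V| is never attained when V is nonempty. *)
Definition min_degree e : nat := \big[minn/#|V|]_(x : V) degree e x.

Definition connected e : bool := [forall x, forall y, connect e x y].

Definition has_cycle_of_size e (k : nat) : bool :=
  (2 < k) && [exists c : k.-tuple V, ucycleb e c].

(* The vertices of a cycle are distinct, so bounding its size by #|V| loses
   nothing here and in circumference. *)
Definition acyclic e : bool :=
  ~~ [exists k : 'I_#|V|.+1, has_cycle_of_size e k].

(* A spanning subgraph is given by its set t of arcs: each edge {x, y} occurs
   in t as both (x, y) and (y, x). *)
Definition adj t : rel V := [rel x y | (x, y) \in t].

Definition spanning_tree e t : bool :=
  [&& [forall x, forall y, adj t x y ==> e x y],
      [forall x, forall y, adj t x y == adj t y x],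
      connected (adj t) & acyclic (adj t)].

Definition leaves t : {set V} := [set x | degree (adj t) x == 1].

Definition leaf_number e : nat :=
  \max_(t : {set V * V} | spanning_tree e t) #|leaves t|.

(* This is 0 for an acyclic graph. *)
Definition circumference e : nat :=
  \max_(k < #|V|.+1 | has_cycle_of_size e k) k.

End Graphs.

(* Main.v *)
Require Import Defs.
From mathcomp Require Import all_boot zify.

(** Growing a connected set S into a spanning tree keeps every vertex of its
    boundary a leaf or replaces it by one, so every connected S has at most
    2d - 1 boundary vertices, d being the minimum degree.  In particular G has no
    cut vertex.  Suppose that a longest cycle C misses at least two vertices and
    let Q be a longest path outside C, with l vertices.

    - l = 1.  C is dominating.  For u outside C let A = N(u) and let A+, A- be the
      successors and predecessors of A on C.  These are independent, and
      |V| <= 3d forces the other vertices outside C to have no neighbour in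
      A+ and A-.  A boundary of size 2d is obtained from u, A minus a suitable
      set D, and possibly one more vertex seeing many vertices of C far from A.

    - 2 <= l < d.  Counting the gaps that the neighbours of both ends of Q leave on
      C, |V| <= 3d forces every vertex of Q to have the same set A of d + 1 - l
      neighbours on C; all gaps between vertices of A then have l inner vertices,
      up to at most one exceptional vertex of G.  Distinct gaps are not linked, so
      almost every vertex is adjacent to all of A and some a in A has degree >= 2d.

    - l >= d.  Two disjoint edges join C to the component H of Q, and the
      neighbourhoods of the two successors on C can be shifted to be disjoint, so
      |H| + 2d <= |V|.  Hence H has d vertices, Q is a Hamiltonian path of H, and
      rotating Q shows that H is attached to a single vertex of C. *)

Set Implicit Arguments.
Unset Strict Implicit.
Unset Printing Implicit Defensive.

(** * Connected sets, their boundaries and leaves *)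

(** Only hypotheses on natural numbers survive, and cardinalities become variables, so [lia] never
    has to process the sets in the context. *)
Ltac nat_lia :=
  repeat match goal with
    | H : is_true (leq _ _) |- _ => revert H
    | H : is_true (andb (leq _ _) (leq _ _)) |- _ => revert H
    | H : is_true (negb (@eq_op ?T ?a ?b)) |- _ => let _ := constr:(a : nat) in revert H
    | H : @eq ?T ?a ?b |- _ => let _ := constr:(a : nat) in change (@eq nat a b) in H; revert H
    end;
  repeat match goal with |- context [@card ?T ?A] => generalize (@card T A) end;
  clear; lia.

Section Growing.
Variables (V : finType) (e : rel V).
Implicit Types (S T A B : {set V}) (x y z w v : V).

Definition nbrs x := [set y | e x y].
Lemma in_nbrs x y : (y \in nbrs x) = e x y.
Proof. by rewrite inE. Qed.

Definition bnd S := [set z | (z \notin S) && [exists s in S, e s z]].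

(** For symmetric [e] these are the nonempty sets inducing a connected subgraph; the order of
    construction supplies the parents in [conn_set_parent]. *)
Inductive conn_set : {set V} -> Prop :=
| conn_set1 x : conn_set [set x]
| conn_setU S s w : conn_set S -> s \in S -> e s w -> conn_set (w |: S).

Lemma in_bnd S s z : s \in S -> e s z -> z \notin S -> z \in bnd S.
Proof. by move=> sS sz zS; rewrite inE zS; apply/exists_inP; exists s. Qed.

Lemma bndP S z : reflect (z \notin S /\ exists2 s, s \in S & e s z) (z \in bnd S).
Proof.
rewrite inE; apply: (iffP andP) => -[zS].
  by move/exists_inP.
by move=> ex; split=> //; apply/exists_inP.
Qed.

Lemma conn_setD S w : conn_set S -> w \in bnd S -> conn_set (w |: S).
Proof. by move=> cS /bndP [_ [s sS sw]]; apply: conn_setU cS sS sw. Qed.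

Lemma conn_set_star u T : T \subset nbrs u -> conn_set (u |: T).
Proof.
move: {2}#|T| (leqnn #|T|) => n; elim: n T => [|n IHn] T.
  rewrite leqn0 cards_eq0 => /eqP -> _; rewrite setU0; exact: conn_set1.
move=> leT sT; have [->|[w wT]] := set_0Vmem T; first by rewrite setU0; exact: conn_set1.
have -> : u |: T = w |: (u |: T :\ w).
  by rewrite setUCA setD1K.
apply: (@conn_setU _ u).
- apply: IHn; first by move: leT; rewrite (cardsD1 w T) wT; lia.
  by apply: subset_trans sT; rewrite subsetDl.
- by rewrite !inE eqxx.
- by move/subsetP: sT => /(_ w wT); rewrite inE.
Qed.

Lemma connect_exit A x y : connect e x y -> x \in A -> y \notin A ->
  exists a b, [/\ a \in A, b \notin A & e a b].
Proof.
move=> /connectP [p]; elim: p x => [|z p IHp] x /=; first by move=> _ -> ->.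
case/andP=> xz pp yl xA yA; case: (boolP (z \in A)) => zA; first exact: IHp pp yl zA yA.
by exists x, z.
Qed.

Hypothesis e_conn : connected e.

Lemma edge_exit A x y : x \in A -> y \notin A ->
  exists a b, [/\ a \in A, b \notin A & e a b].
Proof.
by apply: connect_exit; move/forallP: e_conn => /(_ x) /forallP /(_ y).
Qed.

(** As long as some vertex is neither in S nor in its boundary, a boundary vertex w has a neighbour
    z of that kind. Absorbing w costs w and gains z, so the boundary does not shrink. *)
Lemma conn_set_dominating S : conn_set S ->
  exists S', [/\ conn_set S', #|bnd S| <= #|bnd S'| & S' :|: bnd S' = setT].
Proof.
move: {2}#|~: S| (leqnn #|~: S|) => n; elim: n S => [|n IHn] S leS cS.
  exists S; split=> //; apply/setP => z; rewrite in_setT inE.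
  move: leS; rewrite leqn0 cards_eq0 => /eqP /setP /(_ z); rewrite !inE.
  by move/negbFE ->.
have [all|] := boolP (S :|: bnd S == setT); first by exists S; split=> //; apply/eqP.
rewrite -subTset => /subsetPn [y _ ynS].
have [x xS] : exists x, x \in S.
  by elim: cS => [x|? ? w *]; [exists x; rewrite inE | exists w; rewrite !inE eqxx].
have [w [z [wN zN wz]]] := @edge_exit (S :|: bnd S) x y (subsetP (subsetUl _ _) _ xS) ynS.
have {}wN : w \in bnd S.
  move: wN; rewrite inE => /orP [wS|//]; move: zN; rewrite inE => /norP [zS].
  by rewrite (in_bnd wS wz zS).
move: (zN); rewrite inE negb_or => /andP [zS zB].
have wS : w \notin S by move: wN => /bndP [].
have [||S' [cS' le' eT]] := IHn (w |: S).
- have: ~: S = w |: ~: (w |: S).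
    by apply/setP=> t; rewrite !inE; case: eqP => [->|] //=; rewrite wS.
  move=> eq; move: leS; rewrite eq cardsU1 !inE eqxx /=; lia.
- exact: conn_setD.
exists S'; split=> //; apply: leq_trans le'.
have sub : z |: (bnd S :\ w) \subset bnd (w |: S).
  apply/subsetP => t; rewrite in_setU1 in_setD1 => /orP [/eqP ->|/andP [tw /bndP [tS [s sS st]]]].
    apply: in_bnd wz _; rewrite !inE ?eqxx // negb_or zS andbT.
    by apply: contraNneq zB => ->.
  by apply: in_bnd st _; rewrite !inE ?sS ?orbT // negb_or tw.
have := subset_leq_card sub; rewrite cardsU1 !in_setD1 (negbTE zB) andbF (cardsD1 w (bnd S)) wN; lia.
Qed.

End Growing.

(** * Spanning trees given by parent functions *)

Section Trees.
Variables (V : finType) (e : rel V).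
Hypothesis e_sym : symmetric e.
Implicit Types (S T A B : {set V}) (x y z w v : V).

Section ParentTree.
Variables (r : V) (par : V -> V) (rk : V -> nat).
Hypothesis par_edge : forall x, x != r -> e x (par x).
Hypothesis par_rk : forall x, x != r -> rk (par x) < rk x.

Definition par_arcs : {set V * V} :=
  [set p | (p.1 != r) && (par p.1 == p.2) || (p.2 != r) && (par p.2 == p.1)].

Lemma adj_par_arcs x y :
  adj par_arcs x y = (x != r) && (par x == y) || (y != r) && (par y == x).
Proof. by rewrite /adj /= inE. Qed.

Lemma par_arcs_sym x y : adj par_arcs x y = adj par_arcs y x.
Proof. by rewrite !adj_par_arcs orbC. Qed.

Lemma par_arcs_connect x : connect (adj par_arcs) x r.
Proof.
move: {2}(rk x) (leqnn (rk x)) => n; elim: n x => [|n IHn] x le;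
  have [-> //|xr] := eqVneq x r; have lt := par_rk xr; first lia.
apply: connect_trans (IHn (par x) _); last lia.
by apply: connect1; rewrite adj_par_arcs xr eqxx.
Qed.


(** On a cycle take a vertex of maximal rank: neither of its cycle neighbours can be its child, so
    both are its parent, against distinctness. *)
Lemma par_arcs_acyclic : acyclic (adj par_arcs).
Proof.
apply/existsP => -[k /andP [k2 /existsP [c /andP [cyc uniq_c]]]].
have [x0 x0c] : exists x, x \in tval c.
  by case: (tval c) (size_tuple c) => [|x s] sz; [move: k2; rewrite -sz | exists x; rewrite inE eqxx].
have [x xc x_max] := @arg_maxnP _ x0 (fun x => x \in tval c) rk x0c.
have up y : y \in tval c -> adj par_arcs x y -> par x = y.
  move=> yc; rewrite adj_par_arcs => /orP [] /andP [nr /eqP //] pe.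
  have := par_rk nr; rewrite pe; have := x_max y yc; lia.
have [i s rot_c] := rot_to xc.
have mem_s y : y \in x :: s -> y \in tval c by rewrite -rot_c mem_rot.
have : size (x :: s) = k by rewrite -rot_c size_rot size_tuple.
move: cyc uniq_c; rewrite -(rot_cycle i) -(rot_uniq i) rot_c.
case: s mem_s {rot_c} => [|y s] mem_s /=; first by move=> _ _ sz; move: k2; rewrite -sz.
case/lastP: s mem_s => [|s z] mem_s /=; first by move=> _ _ sz; move: k2; rewrite -sz.
rewrite rcons_path last_rcons => /and3P [xy _ zx] /and3P [_ ynz _] _.
move: zx; rewrite par_arcs_sym => xz.
have := up y _ xy; have := up z _ xz.
rewrite !mem_s ?inE ?eqxx ?orbT ?mem_rcons ?inE ?eqxx ?orbT // => -> // eqzy.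
by move: ynz; rewrite -(eqzy isT) mem_rcons inE eqxx.
Qed.

Lemma par_arcs_spanning_tree : spanning_tree e par_arcs.
Proof.
apply/and4P; split.
- apply/forallP => x; apply/forallP => y; apply/implyP; rewrite adj_par_arcs.
  by case/orP=> /andP [nr /eqP <-]; [|rewrite e_sym]; apply: par_edge.
- by apply/forallP => x; apply/forallP => y; rewrite par_arcs_sym.
- apply/forallP => x; apply/forallP => y.
  apply: connect_trans (par_arcs_connect x) _.
  by rewrite (sym_connect_sym par_arcs_sym); apply: par_arcs_connect.
- exact: par_arcs_acyclic.
Qed.

Lemma par_arcs_leaf x : x != r -> (forall z, z != r -> par z != x) ->
  x \in leaves par_arcs.
Proof.
move=> xr nopar; rewrite inE /degree.
suff -> : [set y | adj par_arcs x y] = [set par x] by rewrite cards1.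
apply/setP => y; rewrite in_set in_set1 adj_par_arcs xr eq_sym /=.
by case: (boolP (y != r)) => yr; rewrite ?(negbTE (nopar _ yr)) ?orbF.
Qed.

End ParentTree.

Lemma conn_set_parent S : conn_set e S ->
  exists r (par : V -> V) (rk : V -> nat), r \in S /\
    {in S, forall x, x != r -> [/\ par x \in S, e x (par x) & rk (par x) < rk x]}.
Proof.
elim=> [x|{}S s w _ [r [par [rk [rS parP]]]] sS sw].
  by exists x, id, (fun=> 0); rewrite inE eqxx; split=> // y; rewrite inE => ->.
have [wS|wS] := boolP (w \in S).
  by exists r, par, rk; rewrite (setUidPr _) ?sub1set.
exists r, (fun x => if x == w then s else par x),
  (fun x => if x == w then (rk s).+1 else rk x).
have neq y : y \in S -> (y == w) = false by move=> yS; apply: contraNF wS => /eqP <-.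
split=> [|x]; first by rewrite !inE rS orbT.
rewrite in_setU1; case: eqP => [-> _ _|_ /= xS xr].
  by rewrite (neq s) // !inE sS orbT e_sym.
by have [pS pe plt] := parP x xS xr; rewrite (neq (par x)) // !inE pS orbT.
Qed.

Hypothesis e_conn : connected e.

(** Once S is enlarged to a dominating S', its parent tree is kept and every other vertex hangs from
    a neighbour in S'. No hanging vertex is a parent, so all of them are leaves. *)
Lemma bnd_leaf_number S : conn_set e S -> #|bnd e S| <= leaf_number e.
Proof.
case/(conn_set_dominating e_conn) => S' [/conn_set_parent [r [par [rk [rS parP]]]] le eT].
apply: leq_trans le _.
pose m := \max_x rk x.
(* The default [r] is never taken, S' being dominating; the rank [m.+1] of a hanging vertex exceeds
   all ranks in S'. *)
pose up x := if x \in S' then par x else odflt r [pick s in S' | e s x].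
pose rk' x := if x \in S' then rk x else m.+1.
have upP x : x != r -> [/\ up x \in S', e x (up x) & rk' (up x) < rk' x].
  move=> xr; rewrite /up /rk'; case: ifP => xS.
    by have [pS pe plt] := parP x xS xr; rewrite pS.
  have : x \in S' :|: bnd e S' by rewrite eT.
  rewrite inE xS /= => /bndP [_ [s0 s0S s0x]].
  case: pickP => [s /andP [sS sx] /=|/(_ s0)]; last by rewrite s0S s0x.
  by rewrite sS e_sym ltnS leq_bigmax.
have st : spanning_tree e (par_arcs r up).
  by apply: (@par_arcs_spanning_tree _ _ rk') => x /upP [].
apply: leq_trans (leq_bigmax_cond _ st); apply: subset_leq_card.
apply/subsetP => x /bndP [xS _]; apply: par_arcs_leaf => [|z zr].
  by apply: contraNneq xS => ->.
by apply: contraNneq xS => <-; case: (upP z zr).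
Qed.

End Trees.

(** * No cut vertex *)

Section CutVertex.
Variables (V : finType) (e : rel V) (d : nat).
Hypotheses (e_sym : symmetric e) (e_irr : irreflexive e) (e_conn : connected e).
Hypotheses (d_gt1 : 1 < d) (deg_ge : forall x, d <= #|nbrs e x|).
Implicit Types (S T A B : {set V}) (x y z w v : V).

(** A is a side of the cut vertex v, and S0 has been grown on the other side. If growth into A
    always shows fewer than d boundary vertices there, a neighbour a of v has exactly d - 1 further
    neighbours T, and the rest Z of A can only be entered through a vertex z with a neighbour z2 in
    Z of degree at most 2. Then d = 2 and A has at least 4 = 2 * d vertices. *)
Lemma side_growth A v S0 : conn_set e S0 -> v \in S0 -> [disjoint S0 & A] ->
  A != set0 -> (forall a, a \in A -> nbrs e a \subset v |: A) -> #|A| < 2 * d ->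
  ~ (forall S, conn_set e S -> S0 \subset S -> S \subset S0 :|: A ->
       #|bnd e S :&: A| < d).
Proof.
move=> cS0 vS0 dis0 /set0Pn [a0 a0A] NA ltA small.
have vA : v \notin A by rewrite (disjointFr dis0).
have nS0 x : x \in A -> x \notin S0 by move=> xA; rewrite (disjointFl dis0).
pose ok S := [/\ conn_set e S, S0 \subset S & S \subset S0 :|: A].
have okU S s t : ok S -> s \in S -> e s t -> t \in A -> ok (t |: S).
  move=> [cS s1 s2] sS st tA; split; first exact: conn_setU cS sS st.
    exact: subset_trans s1 (subsetUr _ _).
  by rewrite subUset sub1set inE tA orbT.
have few S (U : {set V}) : ok S ->
    (forall x, x \in U -> [/\ x \in A, x \notin S & exists2 s, s \in S & e s x]) -> #|U| < d.
  move=> [cS s1 s2] US; apply: leq_ltn_trans (small S cS s1 s2).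
  apply/subset_leq_card/subsetP => x /US [xA xS ex]; rewrite inE xA andbT.
  exact/bndP.
have [a [b [aA bA ab]]] := edge_exit e_conn a0A vA.
have {b bA ab} av : e a v.
  have := subsetP (NA a aA) b; rewrite !inE ab (negbTE bA) orbF => /(_ isT) /eqP <-; exact: ab.
pose T := nbrs e a :\ v.
have inT x : (x \in T) = (x != v) && e a x by rewrite !inE.
have TA x : x \in T -> x \in A.
  rewrite inT => /andP [xv ax]; have := subsetP (NA a aA) x.
  by rewrite in_setU1 inE ax (negbTE xv); apply.
have aT : a \notin T by rewrite inT e_irr andbF.
have Ta x : x \in T -> x != a by apply: contraTneq => ->.
have cardT : d <= #|T|.+1.
  by have := deg_ge a; rewrite (cardsD1 v) inE av.
pose S1 := a |: S0.
have ok1 : ok S1 by apply: (okU _ v); rewrite // ?(e_sym v) //; split=> //; exact: subsetUl.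
have aS1 : a \in S1 by rewrite setU11.
have nS1 x : x \in A -> x != a -> x \notin S1.
  by move=> xA xa; rewrite in_setU1 negb_or xa nS0.
have T1 x : x \in T -> [/\ x \in A, x \notin S1 & exists2 s, s \in S1 & e s x].
  move=> xT; split; [exact: TA | by apply: nS1; [apply: TA | apply: Ta] |].
  by exists a => //; move: xT; rewrite inT => /andP [].
have {}cardT : #|T|.+1 = d by have := few _ _ ok1 T1; nat_lia.
(* Otherwise T and x would be d boundary vertices of S1 in A. *)
have NvT x : x \in A -> e v x -> x != a -> x \in T.
  move=> xA vx xa; apply: contraT => xT.
  suff : #|x |: T| < d by rewrite cardsU1 xT; nat_lia.
  apply: (few _ _ ok1) => y; rewrite in_setU1 => /orP [/eqP ->|yT]; last exact: T1.
  by split=> //; [apply: nS1 | exists v; rewrite // in_setU1 vS0 orbT].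
pose Z := A :\: (a |: T).
have inZ x : (x \in Z) = [&& x != a, x \notin T & x \in A].
  by rewrite in_setD in_setU1 negb_or andbA.
have NZ x y : x \in Z -> e x y -> (y \in T) || (y \in Z).
  rewrite inZ => /and3P [xa xT xA] xy.
  have := subsetP (NA x xA) y; rewrite in_setU1 inE xy => /(_ isT) /orP [/eqP eyv|yA].
    by move: xT; rewrite NvT // e_sym -eyv.
  rewrite inZ yA andbT -implyNb; apply/implyP => ->; rewrite andbT.
  apply: contraNneq xT => eya; rewrite inT e_sym -eya xy andbT.
  by apply: contraNneq vA => <-.
(* If Z is empty, A has only d vertices, so each needs v as a neighbour to reach degree d, and S0
   alone has d boundary vertices in A. *)
have [Z0|[z0 z0Z]] := set_0Vmem Z.
  have eA : A = a |: T.
    apply/eqP; rewrite eqEsubset -setD_eq0 -/Z Z0 eqxx /= subUset sub1set aA.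
    by apply/subsetP => x; apply: TA.
  have cA : #|A| = d by rewrite eA cardsU1 aT add1n.
  suff : #|A| < d by nat_lia.
  apply: (few S0) => [|x xA]; first by split=> //; exact: subsetUl.
  split=> //; first exact: nS0.
  exists v => //; rewrite e_sym; apply: contraT => xv.
  have : nbrs e x \subset A :\ x.
    apply/subsetP => y xy; have := subsetP (NA x xA) y xy; rewrite !inE.
    rewrite inE in xy; case: eqP => [eyv|_ /= ->]; first by rewrite -eyv xy in xv.
    by rewrite andbT; apply: contraTneq xy => ->; rewrite e_irr.
  move/subset_leq_card; have := deg_ge x; have := cardsD1 x A; rewrite xA; nat_lia.
have aZ : a \notin Z by rewrite inZ eqxx.
have [z [w [zZ wZ zw]]] := edge_exit e_conn z0Z aZ.
have {wZ} wT : w \in T by have := NZ z w zZ zw; rewrite (negbTE wZ) orbF.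
have ZA x : x \in Z -> x \in A by rewrite inZ => /and3P [].
have ZT x : x \in Z -> x \notin T by rewrite inZ => /and3P [].
have neqTZ x y : x \in T -> y \in Z -> x != y.
  by move=> xT yZ; apply: contraNneq (ZT y yZ) => <-.
(* T without t already accounts for d - 2 of the at most d - 1 boundary vertices, leaving room for
   one in Z. *)
have cardTU t (U : {set V}) : t \in T -> U \subset Z -> #|(T :\ t) :|: U| < d -> #|U| <= 1.
  move=> tT UZ; rewrite cardsU (_ : _ :&: _ = set0) ?cards0; last first.
    apply/setP => x; rewrite in_set0; apply/negP; rewrite in_setI in_setD1.
    by case/andP=> /andP [_ xT] /(subsetP UZ) /ZT; rewrite xT.
  have := cardsD1 t T; rewrite tT; nat_lia.
have okT t : t \in T -> ok (t |: S1).
  by move=> tT; apply: (okU _ a) => //; [move: tT; rewrite inT => /andP [] | exact: TA].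
have one t : t \in T -> #|nbrs e t :&: Z| <= 1.
  move=> tT; apply: (cardTU t) => //; first exact: subsetIr.
  apply: (few _ _ (okT t tT)) => x; rewrite in_setU in_setD1 in_setI in_nbrs.
  case/orP => [/andP [xt xT]|/andP [tx xZ]].
    have [xA xS [s sS sx]] := T1 x xT; split=> //; first by rewrite in_setU1 negb_or xt.
    by exists s; rewrite // in_setU1 sS orbT.
  split; [exact: ZA | | by exists t; rewrite ?setU11].
  by rewrite in_setU1 negb_or eq_sym neqTZ // nS1 ?ZA //; move: xZ; rewrite inZ => /and3P [].
pose S2 := w |: S1; pose S3 := z |: S2.
have ok2 : ok S2 by apply: okT.
have ok3 : ok S3 by apply: (okU _ w); rewrite ?setU11 ?(e_sym w) ?ZA.
have TS3 t : t \in T :\ w -> [/\ t \in A, t \notin S3 & exists2 s, s \in S3 & e s t].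
  rewrite in_setD1 => /andP [tw tT]; have [tA tS [s sS st]] := T1 t tT; split=> //.
    by rewrite !in_setU1 -in_setU1 !negb_or tw neqTZ.
  by exists s; rewrite // !in_setU1 -in_setU1 sS !orbT.
have nS2 x : x \in Z -> x \notin S2.
  move=> xZ; rewrite in_setU1 negb_or eq_sym neqTZ // nS1 ?ZA //.
  by move: xZ; rewrite inZ => /and3P [].
have one3 : #|nbrs e z :&: Z| <= 1.
  apply: (cardTU w) => //; first exact: subsetIr.
  apply: (few _ _ ok3) => x; rewrite in_setU in_setI in_nbrs => /orP [xT|/andP [zx xZ]]; first exact: TS3.
  split; [exact: ZA | | by exists z; rewrite ?setU11].
  by rewrite in_setU1 negb_or nS2 // andbT; apply: contraTneq zx => ->; rewrite e_irr.
have Nz : nbrs e z = (nbrs e z :&: T) :|: (nbrs e z :&: Z).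
  apply/setP => x; rewrite -setIUr in_setI in_setU in_nbrs; case zx: (e z x) => //=.
  by rewrite (NZ z x).
have := deg_ge z; rewrite {}[X in #|pred_of_set X|]Nz cardsU => cz.
(* All neighbours of z lie in T and Z, at most one of them in Z, so its degree forces all d - 1
   vertices of T and one z2 in Z. *)
have TNz : T \subset nbrs e z.
  apply/setIidPr/eqP; rewrite eqEcard subsetIr /=; nat_lia.
have [z2 z2N] : exists z2, z2 \in nbrs e z :&: Z.
  apply/set0Pn; rewrite -card_gt0; have := subset_leq_card (subsetIr (nbrs e z) T); nat_lia.
move: z2N; rewrite in_setI in_nbrs => /andP [zz2 z2Z].
have z2z : z2 != z by apply: contraTneq zz2 => ->; rewrite e_irr.
have ok4 : ok (z2 |: S3) by apply: (okU _ z); rewrite ?setU11 ?ZA.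
have one4 : #|(nbrs e z2 :&: Z) :\ z| <= 1.
  apply: (cardTU w) => //; first by apply: subset_trans (subsetIr (nbrs e z2) Z); apply: subsetDl.
  apply: (few _ _ ok4) => x; rewrite in_setU [x \in _ :\ z]in_setD1 in_setI in_nbrs.
  case/orP => [xT|/and3P [xz zx xZ]].
    have [tA tS [s sS st]] := TS3 x xT; split=> //; last by exists s; rewrite // in_setU1 sS orbT.
    by rewrite in_setU1 negb_or tS andbT; apply: neqTZ => //; move: xT; rewrite in_setD1 => /andP [].
  split; [exact: ZA | | by exists z2; rewrite ?setU11].
  rewrite 2!in_setU1 !negb_or nS2 // andbT xz andbT.
  by apply: contraTneq zx => ->; rewrite e_irr.
have Nz2 : nbrs e z2 \subset z |: ((nbrs e z2 :&: Z) :\ z).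
  apply/subsetP => x; rewrite inE => z2x; rewrite in_setU1 in_setD1 in_setI in_nbrs z2x /=.
  case: eqP => //= _; have /orP [xT|//] := NZ z2 x z2Z z2x.
  (* A vertex x of T adjacent to z2 would have the two neighbours z and z2 in Z. *)
  suff : 2 <= #|nbrs e x :&: Z| by have := one x xT; nat_lia.
  have := subsetP TNz x xT; rewrite in_nbrs => zx.
  rewrite (cardsD1 z) (cardsD1 z2) in_setD1 z2z !in_setI !in_nbrs.
  by rewrite (e_sym x) zx e_sym z2x zZ z2Z.
have : #|[set z; z2] :|: (a |: T)| <= #|A|.
  apply/subset_leq_card/subsetP => x; rewrite in_setU in_set2 in_setU1.
  by case/orP=> /orP [/eqP ->|]; [apply: ZA|move/eqP->; apply: ZA|by []|apply: TA].
rewrite cardsU (_ : _ :&: _ = set0) ?cards0; last first.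
  apply/setP => x; rewrite in_set0 in_setI in_set2; apply/negP => /andP [xz].
  have : x \in Z by case/orP: xz => /eqP ->.
  by rewrite in_setD => /andP [/negbTE ->].
rewrite cards2 cardsU1 aT eq_sym z2z.
have := subset_leq_card Nz2; rewrite cardsU1 => c2; have := deg_ge z2.
move: c2; case: (_ \notin _) => /=; nat_lia.
Qed.

(** Each side has at least d vertices and together they have at most 3 * d - 1, so both are smaller
    than 2 * d and [side_growth] applies twice: from v into A, then from the result into B. The
    boundary vertices in A survive the second growth, which gives 2 * d in total. *)
Lemma no_cut_vertex v A B : (forall S, conn_set e S -> #|bnd e S| < 2 * d) ->
  #|V| <= 3 * d -> A != set0 -> B != set0 -> [disjoint A & B] ->
  v \notin A -> v \notin B -> A :|: B = [set~ v] ->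
  (forall a b, a \in A -> b \in B -> ~~ e a b) -> False.
Proof.
move=> leafb order A0 B0 dis vA vB eU noedge.
have NA a : a \in A -> nbrs e a \subset v |: A.
  move=> aA; apply/subsetP => x; rewrite inE in_setU1 => ax; case: eqVneq => //= xv.
  have : x \in A :|: B by rewrite eU !inE.
  by rewrite inE => /orP [//|xB]; have := noedge a x aA xB; rewrite ax.
have NB b : b \in B -> nbrs e b \subset v |: B.
  move=> bB; apply/subsetP => x; rewrite inE in_setU1 => bx; case: eqVneq => //= xv.
  have : x \in A :|: B by rewrite eU !inE.
  by rewrite inE => /orP [xA|//]; have := noedge x b xA bB; rewrite e_sym bx.
have big C : C != set0 -> (forall c, c \in C -> nbrs e c \subset v |: C) -> v \notin C -> d <= #|C|.
  move=> /set0Pn [c cC] NC vC; apply: leq_trans (deg_ge c) _.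
  have : nbrs e c \subset v |: (C :\ c).
    apply/subsetP => x xc; have := subsetP (NC c cC) x xc; rewrite !in_setU1 in_setD1.
    case/orP=> [->//|->]; rewrite andbT; case: eqP => //= _; apply: contraTneq xc => ->.
    by rewrite inE e_irr.
  move/subset_leq_card; rewrite cardsU1 (cardsD1 c C) cC; case: (_ \notin _) => /=; nat_lia.
have cardAB : #|A| + #|B| = #|V|.-1.
  by have := cardsU A B; rewrite eU (disjoint_setI0 dis) cards0 cardsC1; nat_lia.
have dA := big A A0 NA vA; have dB := big B B0 NB vB.
have vS : v \in [set v] by rewrite inE.
apply: (side_growth (conn_set1 e v) vS _ A0 NA) => [||S cS s1 s2]; [by rewrite disjoints1 | nat_lia |].
rewrite ltnNge; apply/negP => SA.
have dSB : [disjoint S & B].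
  rewrite disjoint_sym; apply/pred0P => x /=; apply/negP => /andP [xB /(subsetP s2)].
  rewrite in_setU1 (disjointFl dis xB) orbF => /eqP xv; by rewrite -xv xB in vB.
apply: (side_growth cS (subsetP s1 v vS) dSB B0 NB) => [|S' cS' s1' s2']; first nat_lia.
rewrite ltnNge; apply/negP => SB.
have := leafb S' cS'; apply/negP; rewrite -leqNgt.
have sub : (bnd e S :&: A) :|: (bnd e S' :&: B) \subset bnd e S'.
  rewrite subUset subsetIl andbT; apply/subsetP => x; rewrite inE => /andP [/bndP [xS [s sS sx]] xA].
  apply: (in_bnd (subsetP s1' s sS) sx); apply: contra xS => /(subsetP s2').
  by rewrite inE (disjointFr dis xA) orbF.
have disAB : (bnd e S :&: A) :&: (bnd e S' :&: B) = set0.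
  apply/setP => x; rewrite in_set0 !in_setI; apply/negP => /andP [/andP [_ xA] /andP [_]].
  by rewrite (disjointFr dis xA).
by have := subset_leq_card sub; rewrite cardsU disAB cards0; nat_lia.
Qed.

End CutVertex.

(** * The dominating case: choosing the connected set *)

Lemma subset_of_size (T : finType) (A : {set T}) k : k <= #|A| ->
  exists2 D : {set T}, D \subset A & #|D| = k.
Proof.
move=> le; exists [set x in take k (enum A)].
  by apply/subsetP => x; rewrite inE => /mem_take; rewrite mem_enum.
rewrite cardsE; have /card_uniqP -> : uniq (take k (enum A)) by rewrite take_uniq ?enum_uniq.
by rewrite size_take -cardE; case: ltngtP le.
Qed.

Section Star.
Variables (V : finType) (e : rel V) (d : nat).
Hypotheses (e_sym : symmetric e) (e_irr : irreflexive e).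
Hypotheses (deg_ge : forall x, d <= #|nbrs e x|).
Hypothesis leafb : forall S, conn_set e S -> #|bnd e S| < 2 * d.
Implicit Types (S T A B D : {set V}) (x y z w v : V).

Variables (u : V) (R P1 P2 : {set V}).
(** In the application u lies outside the cycle, P1 and P2 are the successors and predecessors of A,
    and R is the rest of the complement of the cycle. K is the set to be dominated, M the set of
    cycle vertices neither in A nor next to it, and [t z] what absorbing z gains in M. *)
Let A := nbrs e u.
Let P := P1 :|: P2.
Let K := P :|: R.
Let M := ~: (u |: A :|: P :|: R).
Let NA z := nbrs e z :&: A.
Let t z := #|nbrs e z :&: M|.

Hypotheses (uP : u \notin P) (uR : u \notin R).
Hypotheses (disPA : [disjoint P & A]) (disRA : [disjoint R & A]) (disRP : [disjoint R & P]).

Let neqA z w : z \in K -> w \in A -> z != w.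
Proof.
rewrite inE => zK wA; apply: contraTneq wA => <-.
by case/orP: zK => zK; rewrite ?(disjointFr disPA zK) ?(disjointFr disRA zK).
Qed.

Let neqKM z w : z \in K -> w \in M -> z != w.
Proof.
move=> zK; apply: contraTneq => <-; move: zK.
by rewrite in_setC negbK [z \in K]in_setU 2!in_setU => /orP [] ->; rewrite ?orbT.
Qed.

Let uK : u \notin K.
Proof. by rewrite inE negb_or uP. Qed.

Let uM z : z \in M -> z != u.
Proof. by apply: contraTneq => ->; rewrite in_setC negbK !in_setU set11. Qed.

Let uA : u \notin A.
Proof. by rewrite in_nbrs e_irr. Qed.

Let cardK : #|K| = #|P| + #|R|.
Proof.
by rewrite cardsU (_ : P :&: R = set0) ?cards0 ?subn0 //; apply: disjoint_setI0; rewrite disjoint_sym.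
Qed.

Let cardDK D : D \subset A -> #|D :|: K| = #|D| + #|K|.
Proof.
move=> DA; rewrite cardsU (_ : D :&: K = set0) ?cards0 ?subn0 //.
apply/setP => x; rewrite in_set0 in_setI; apply/negP => /andP [xD xK].
by have := neqA xK (subsetP DA x xD); rewrite eqxx.
Qed.

Let notNA z D : ~~ (NA z \subset D) -> exists2 w, w \in A :\: D & e w z.
Proof.
case/subsetPn => w; rewrite in_setI in_nbrs => /andP [zw wA] wD.
by exists w; [rewrite in_setD wD | rewrite e_sym].
Qed.

(** The star on u and [A :\: D] has D in its boundary because of u, and K because each vertex of K
    has a neighbour in [A :\: D]. *)
Lemma star_bound D : D \subset A -> (forall z, z \in K -> ~~ (NA z \subset D)) ->
  #|D| + #|P| + #|R| < 2 * d.
Proof.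
move=> DA dom; have cS : conn_set e (u |: (A :\: D)) by apply: conn_set_star; apply: subsetDl.
apply: leq_ltn_trans (leafb cS); rewrite -addnA -cardK -(cardDK DA).
apply/subset_leq_card/subsetP => x; rewrite in_setU => /orP [xD|xK].
  have xA := subsetP DA x xD.
  apply: (@in_bnd _ _ _ u); rewrite ?setU11 -?in_nbrs //.
  by rewrite in_setU1 in_setD xD orbF; apply: contraTneq xA => ->.
have [w wAD wx] := notNA (dom x xK).
apply: (in_bnd _ wx); first by rewrite in_setU wAD orbT.
rewrite in_setU1 in_setD !negb_or; apply/andP; split; first by apply: contraTneq xK => ->.
by apply/negP => /andP [_ xA]; have := neqA xK xA; rewrite eqxx.
Qed.

(** Absorbing y into the star costs y itself, hence the extra 1, and gains its neighbours in M; a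
    vertex of K may now be dominated by y instead of by A. *)
Lemma star_bound_plus D y : D \subset A -> y \in K -> ~~ (NA y \subset D) ->
  (forall z, z \in K -> z != y -> ~~ (NA z \subset D) || e y z) ->
  #|D| + #|P| + #|R| + t y < (2 * d).+1.
Proof.
move=> DA yK yD dom; pose S := u |: (A :\: D).
have cS : conn_set e S by apply: conn_set_star; apply: subsetDl.
have [w wAD wy] := notNA yD.
have cSy : conn_set e (y |: S) by apply: conn_setU cS _ wy; rewrite in_setU1 wAD orbT.
have nS x : x \in K -> x \notin S.
  move=> xK; rewrite in_setU1 in_setD !negb_or; apply/andP; split; first by apply: contraTneq xK => ->.
  by apply/negP => /andP [_ xA]; have := neqA xK xA; rewrite eqxx.
have sub : ((D :|: K) :\ y) :|: (nbrs e y :&: M) \subset bnd e (y |: S).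
  rewrite subUset; apply/andP; split; apply/subsetP => x.
    rewrite in_setD1 in_setU => /andP [xy /orP [xD|xK]].
      have xA := subsetP DA x xD.
      apply: (@in_bnd _ _ _ u); first by rewrite 2!in_setU1 eqxx orbT.
        by rewrite -in_nbrs.
      by rewrite 2!in_setU1 in_setD xD orbF negb_or xy; apply: contraTneq xA => ->.
    have /orP [xND|yx] := dom x xK xy.
      have [w' w'AD w'x] := notNA xND; apply: (in_bnd _ w'x); rewrite ?in_setU1 ?w'AD ?orbT //.
      by rewrite -in_setU1 negb_or xy nS.
    by apply: (in_bnd _ yx); rewrite ?setU11 // in_setU1 negb_or xy nS.
  rewrite in_setI in_nbrs => /andP [yx xM]; apply: (in_bnd _ yx); rewrite ?setU11 //.
  rewrite in_setU1 negb_or eq_sym neqKM // in_setU1 negb_or uM //=.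
  apply: contraL xM => /setDP [xA _].
  by rewrite in_setC negbK !in_setU xA !orbT.
have dis0 : ((D :|: K) :\ y) :&: (nbrs e y :&: M) = set0.
  apply/setP => x; rewrite in_set0 !in_setI in_setD1 in_setU; apply/negP.
  case/andP=> /andP [_ /orP [xD|xK]] /andP [_ xM]; last by have := neqKM xK xM; rewrite eqxx.
  by move: xM; rewrite in_setC !in_setU (subsetP DA x xD) !orbT.
have := subset_leq_card sub; rewrite cardsU dis0 cards0.
have := cardsD1 y (D :|: K); rewrite in_setU yK orbT (cardDK DA) cardK.
have := leafb cSy; rewrite /t; nat_lia.
Qed.

(* If z is adjacent to all of [Q2 :\: Q1], then [Q1 :\: Q2] alone has to be dominated from A,
   and for that it suffices that D avoids the w with [f w \notin Q2]. *)
Lemma star_bound_aligned (Q1 Q2 : {set V}) (f : V -> V) z k :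
  P = Q1 :|: Q2 -> {in A &, injective f} -> {in A, forall w, e w (f w)} ->
  Q1 = f @: A -> z \in Q1 :\: Q2 -> Q2 :\: Q1 \subset nbrs e z ->
  k <= #|Q1 :&: Q2| ->
  {in K, forall y, y \notin Q1 :\: Q2 -> y \notin Q2 :\: Q1 -> k < #|NA y|} ->
  k + #|P| + #|R| + t z < (2 * d).+1.
Proof.
move=> eP inj_f ef eQ zQ Q21 lek big.
pose F := [set w in A | f w \notin Q2].
have FA : F \subset A by apply/subsetP => w; rewrite inE => /andP [].
have eF : f @: F = Q1 :\: Q2.
  apply/setP => x; apply/imsetP/setDP => [[w wF ->]|[]].
    by move: wF; rewrite in_set => /andP [wA ?]; split=> //; rewrite eQ imset_f.
  by rewrite eQ => /imsetP [w wA ->] nQ; exists w; rewrite // in_set wA.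
have cF : #|F| = #|Q1 :\: Q2|.
  by rewrite -eF card_in_imset // => w w' /(subsetP FA) wA /(subsetP FA); apply: inj_f.
have cQ1 : #|Q1| = #|A| by rewrite eQ card_in_imset.
have [|D DAF cD] := @subset_of_size _ (A :\: F) k.
  have := cardsID F A; rewrite (setIidPr FA); have := cardsID Q2 Q1; nat_lia.
have DA : D \subset A := subset_trans DAF (subsetDl _ _).
have hit y : y \in Q1 :\: Q2 -> ~~ (NA y \subset D).
  rewrite -eF => /imsetP [w wF ->]; apply/subsetPn; exists w.
    by rewrite in_setI (subsetP FA) // in_nbrs e_sym ef // (subsetP FA).
  by apply: contraL wF => /(subsetP DAF) /setDP [].
have zK : z \in K by rewrite in_setU eP in_setU; case/setDP: zQ => ->.
rewrite -cD; apply: star_bound_plus; rewrite ?hit // => y yK yz.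
have [/hit -> //|yQ12] := boolP (y \in Q1 :\: Q2).
have [/(subsetP Q21)|yQ21] := boolP (y \in Q2 :\: Q1); first by rewrite in_nbrs orbC => ->.
apply/orP; left; apply: contraL (big y yK yQ12 yQ21) => /subset_leq_card.
by rewrite cD leqNgt.
Qed.

Hypothesis R_neq0 : R != set0.
Hypothesis R_indep : {in R &, forall v w, ~~ e v w}.
Hypothesis R_P : {in R & P, forall v z, ~~ e v z}.
Hypothesis R_A : {in R, forall v, NA v != set0}.
Variables f1 f2 : V -> V.
Hypotheses (inj_f1 : {in A &, injective f1}) (inj_f2 : {in A &, injective f2}).
Hypotheses (ef1 : {in A, forall w, e w (f1 w)}) (ef2 : {in A, forall w, e w (f2 w)}).
Hypotheses (eP1 : P1 = f1 @: A) (eP2 : P2 = f2 @: A).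
Hypotheses (P1_indep : {in P1 &, forall y z, ~~ e y z}).
Hypotheses (P2_indep : {in P2 &, forall y z, ~~ e y z}).
Hypothesis M_eq0 : P1 = P2 -> M = set0.

Let deg_split z : #|nbrs e z :\ u| <= #|NA z| + #|nbrs e z :&: P| + #|nbrs e z :&: R| + t z.
Proof.
have : nbrs e z :\ u \subset NA z :|: (nbrs e z :&: P) :|: (nbrs e z :&: R) :|: (nbrs e z :&: M).
  apply/subsetP => x /setD1P [xu zx]; rewrite /NA /M 3!in_setU 4!in_setI zx /= in_setC 3![in X in ~~ X]in_setU in_set1.
  by case: eqP xu => //= _ _; case: (x \in A); case: (x \in P); case: (x \in R).
move/subset_leq_card/leq_trans; apply; rewrite !cardsU /t; nat_lia.
Qed.

Let nu z : z \in K -> nbrs e z :\ u = nbrs e z.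
Proof.
move=> zK; apply/setP => x; rewrite in_setD1 in_nbrs; case: eqP => //= ->.
apply/esym/negP; rewrite e_sym -in_nbrs => /(neqA zK); by rewrite eqxx.
Qed.

Let deg_R v : v \in R -> d <= #|NA v| + t v.
Proof.
move=> vR; have := deg_split v; rewrite nu ?in_setU ?vR ?orbT //.
have -> : nbrs e v :&: P = set0.
  apply/setP => x; rewrite in_set0 in_setI in_nbrs; apply/negP => /andP [vx xP].
  by have := R_P vR xP; rewrite vx.
have -> : nbrs e v :&: R = set0.
  apply/setP => x; rewrite in_set0 in_setI in_nbrs; apply/negP => /andP [vx xP].
  by have := R_indep vR xP; rewrite vx.
rewrite cards0 !addn0; exact: leq_trans.
Qed.

Let deg_Q Q1 Q2 z : P = Q1 :|: Q2 -> {in Q1 &, forall x y, ~~ e x y} -> z \in Q1 ->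
  d <= #|NA z| + #|nbrs e z :&: (Q2 :\: Q1)| + t z.
Proof.
move=> eP ind zQ; have zP : z \in P by rewrite eP in_setU zQ.
have zK : z \in K by rewrite in_setU zP.
have := deg_split z; rewrite nu //.
have -> : nbrs e z :&: P = nbrs e z :&: (Q2 :\: Q1).
  apply/setP => x; rewrite !in_setI in_nbrs eP in_setU in_setD; case zx: (e z x) => //=.
  by have [xQ|//] := boolP (x \in Q1); have := ind z x zQ xQ; rewrite zx.
have -> : nbrs e z :&: R = set0.
  apply/setP => x; rewrite in_set0 in_setI in_nbrs; apply/negP => /andP [zx xP].
  by have := R_P xP zP; rewrite e_sym zx.
rewrite cards0 !addn0; exact: leq_trans.
Qed.

(** D is made just large enough to contradict [star_bound] if no vertex of K has neighbours in M,
    and otherwise [star_bound_plus] at a vertex of K maximizing [t]. The degree bounds keep [NA z]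
    larger than D, apart from the tight vertices treated below. *)
Lemma star_dominating : False.
Proof.
have cA : d <= #|A| := deg_ge u.
have cP1 : #|P1| = #|A| by rewrite eP1 card_in_imset.
have cP2 : #|P2| = #|A| by rewrite eP2 card_in_imset.
have cP : #|P| + #|P1 :&: P2| = 2 * #|A| by rewrite cardsUI cP1 cP2 mul2n addnn.
have c12 : #|P1 :\: P2| + #|P1 :&: P2| = #|A| by rewrite addnC cardsID.
have c21 : #|P2 :\: P1| + #|P1 :&: P2| = #|A| by rewrite addnC setIC cardsID.
have cR : 0 < #|R| by rewrite card_gt0.
have PC : P = P2 :|: P1 by rewrite /P setUC.
have NA_gt0 z : z \in K -> 0 < #|NA z|.
  rewrite card_gt0 in_setU => /orP [zP|]; last exact: R_A.
  by apply/set0Pn; move: zP; rewrite in_setU eP1 eP2 => /orP [] /imsetP [w wA ->];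
    exists w; rewrite in_setI wA in_nbrs e_sym ?ef1 ?ef2.
have deg1 z : z \in P1 -> d <= #|NA z| + #|nbrs e z :&: (P2 :\: P1)| + t z by apply: deg_Q.
have deg2 z : z \in P2 -> d <= #|NA z| + #|nbrs e z :&: (P1 :\: P2)| + t z by apply: deg_Q.
have degP z : z \in P -> d + #|P1 :&: P2| <= #|NA z| + #|A| + t z.
  have := subset_leq_card (subsetIr (nbrs e z) (P2 :\: P1)).
  have := subset_leq_card (subsetIr (nbrs e z) (P1 :\: P2)).
  rewrite in_setU => l1 l2 /orP [/deg1|/deg2]; nat_lia.
have degK z : z \in K -> z \notin P1 :\: P2 -> z \notin P2 :\: P1 -> d <= #|NA z| + t z.
  move=> zK.
  move: zK; rewrite 2!in_setU !in_setD; case z1: (z \in P1); case z2: (z \in P2) => //= zR _ _.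
    have := deg1 z z1; rewrite (_ : nbrs e z :&: _ = set0) ?cards0 ?addn0 //.
    apply/setP => x; rewrite in_set0 in_setI in_nbrs in_setD; apply/negP => /and3P [zx _ xP].
    by have := P2_indep z2 xP; rewrite zx.
  exact: deg_R.
have [/forall_inP t0|] := boolP [forall z in K, t z == 0].
  (* With this size [#|D| + #|P| + #|R|] is at least 2 * d; if the subtraction truncates, P and R
     alone suffice. *)
  have [|D DA cD] := @subset_of_size _ A (#|P1 :&: P2| + 2 * d - (2 * #|A| + #|R|)); first nat_lia.
  have : #|D| + #|P| + #|R| < 2 * d; last by nat_lia.
  apply: star_bound => // z zK; have /eqP tz := t0 z zK.
  apply/negP => /subset_leq_card; have := NA_gt0 z zK; rewrite cD.
  move: zK; rewrite in_setU => /orP [/degP|/deg_R]; rewrite tz; nat_lia.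
case/forall_inPn => y0 y0K ty0.
have [y yK y_max] := @arg_maxnP _ y0 (fun x => x \in K) t y0K.
have ty : 0 < t y by apply: leq_trans (y_max y0 y0K); rewrite lt0n.
have t_max z : z \in K -> t z <= t y := y_max z.
have p_lt : #|P1 :&: P2| < #|A|.
  rewrite ltnNge; apply/negP => ge; have eq12 : P1 = P2.
    have s1 : P1 \subset P2.
      by rewrite -setD_eq0 -cards_eq0; move: ge c12; nat_lia.
    by apply/eqP; rewrite eqEcard s1 /=; nat_lia.
  by move: ty; rewrite /t (M_eq0 eq12) setI0 cards0.
(* The least size for which [k + #|P| + #|R| + t y] reaches 2 * d + 1. *)
pose k := #|P1 :&: P2| + 2 * d + 1 - (2 * #|A| + #|R| + t y).
have kE : k = #|P1 :&: P2| + 2 * d + 1 - (2 * #|A| + #|R| + t y) by [].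
have enough z : t z = t y -> ~ (k + #|P| + #|R| + t z < (2 * d).+1).
  by move=> ->; move: (t y) ty kE => ty' *; nat_lia.
have good z : z \in K -> z \notin P1 :\: P2 -> z \notin P2 :\: P1 -> k < #|NA z|.
  move=> zK z12 z21; have := degK z zK z12 z21; have := t_max z zK; have := NA_gt0 z zK.
  by move: (t z) (t y) ty kE => tz ty' *; nat_lia.
(* A vertex with few neighbours in A attains equality in all the degree estimates,
   which makes [star_bound_aligned] applicable to it. *)
have tight (Q1 Q2 : {set V}) z : #|Q2 :\: Q1| + #|P1 :&: P2| = #|A| ->
    d <= #|NA z| + #|nbrs e z :&: (Q2 :\: Q1)| + t z -> z \in K -> #|NA z| <= k ->
    t z = t y /\ Q2 :\: Q1 \subset nbrs e z.
  move=> cQ dz zK lek; have tz := t_max z zK; have n0 := NA_gt0 z zK.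
  have lq := subset_leq_card (subsetIr (nbrs e z) (Q2 :\: Q1)).
  split; first by move: (t z) (t y) tz ty kE dz => tz' ty' *; nat_lia.
  apply/setIidPr/eqP; rewrite eqEcard subsetIr /=.
  by move: (t z) (t y) tz ty kE dz => tz' ty' *; nat_lia.
have [/exists_inP [z zK lez]|] := boolP [exists z in K, #|NA z| <= k].
  have [z12|z12] := boolP (z \in P1 :\: P2).
    have [zP1 _] := setDP z12.
    have [tz s21] := tight P1 P2 z c21 (deg1 z zP1) zK lez.
    apply: (enough z tz); apply: (star_bound_aligned (Q1 := P1) (Q2 := P2) _ inj_f1) => //.
    by move: (t y) ty kE => ty' *; nat_lia.
  have [z21|z21] := boolP (z \in P2 :\: P1).
    have [zP2 _] := setDP z21.
    have [tz s12] := tight P2 P1 z c12 (deg2 z zP2) zK lez.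
    apply: (enough z tz); apply: (star_bound_aligned (Q1 := P2) (Q2 := P1) _ inj_f2) => //.
      by rewrite setIC; move: (t y) ty kE => ty' *; nat_lia.
    by move=> x xK x1 x2; apply: good.
  by have := good z zK z12 z21; rewrite ltnNge lez.
move/exists_inPn => nobad.
have [|D DA cD] := @subset_of_size _ A k; first by move: (t y) ty kE => ty' *; nat_lia.
apply: (enough y) => //; rewrite -cD.
have out z : z \in K -> ~~ (NA z \subset D).
  by move=> zK; apply/negP => /subset_leq_card; rewrite cD; apply/negP; apply: nobad.
by apply: star_bound_plus => //; [apply: out | move=> z zK _; rewrite out].
Qed.

End Star.

(** * Exchanges on a longest cycle *)

Lemma iota_head m n : 0 < n -> iota m n = m :: iota m.+1 n.-1.
Proof. by case: n. Qed.

Lemma iota_last m n : iota m n.+1 = rcons (iota m n) (m + n).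
Proof. by rewrite -addn1 iotaD /= cats1. Qed.

Ltac count_lia :=
  repeat (move: (nat_of_bool _) => ?); repeat (move: (count _ _) => ?); lia.

Section LongestCycle.
Variables (V : finType) (e : rel V).
Hypotheses (e_sym : symmetric e).
Variables (N : nat) (g : nat -> V).
(* The cycle is the N-periodic sequence g. *)
Definition longest_cycle := [/\ 2 < N, forall i, e (g i) (g i.+1),
  forall i, g (i + N) = g i, forall i j, i < N -> j < N -> g i = g j -> i = j
  & forall c, cycle e c -> uniq c -> size c <= N].

Hypothesis cC : longest_cycle.
Let N_gt2 : 2 < N. Proof. by case: cC. Qed.
Let g_edge i : e (g i) (g i.+1). Proof. by case: cC. Qed.
Let g_per i : g (i + N) = g i. Proof. by case: cC. Qed.
Let g_inj i j : i < N -> j < N -> g i = g j -> i = j. Proof. by case: cC => _ _ _ + _; apply. Qed.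
Let cycle_le c : cycle e c -> uniq c -> size c <= N. Proof. by case: cC => _ _ _ _; apply. Qed.

Definition cyc : {set V} := [set x in [seq g i | i <- iota 0 N]].

Lemma g_mod i : g (i %% N) = g i.
Proof.
rewrite {2}(divn_eq i N) addnC; elim: (i %/ N) => [|k IHk]; first by rewrite mul0n addn0.
by rewrite mulSn (addnC N) addnA g_per.
Qed.

Lemma mem_cyc i : g i \in cyc.
Proof.
rewrite inE -g_mod; apply/mapP; exists (i %% N) => //.
by rewrite mem_iota add0n ltn_mod; lia.
Qed.

Lemma cycP x : x \in cyc -> forall i, exists2 k, i <= k < i + N & x = g k.
Proof.
rewrite inE => /mapP [k0 + ->]; rewrite mem_iota add0n => k0N i.
exists (i + (k0 + N - i %% N) %% N).
  by rewrite leq_addr ltn_add2l ltn_mod; lia.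
rewrite -[LHS]g_mod -[RHS]g_mod -modnDml modnDmr; congr g.
have im : i %% N < N by rewrite ltn_mod; lia.
by rewrite addnBA ?modnDl; [rewrite addnC addnK modnDr | lia].
Qed.

Lemma g_window i j k : i <= j < i + N -> i <= k < i + N -> g j = g k -> j = k.
Proof.
have N0 : 0 < N by lia.
rewrite -(g_mod j) -(g_mod k) => jw kw /g_inj; rewrite !ltn_mod => /(_ N0 N0) eqm.
have := divn_eq j N; have := divn_eq k N; have := ltn_pmod k N0.
rewrite -eqm; move: (j %/ N) (k %/ N) (j %% N) => a b r _ ek ej.
case: (ltngtP a b) ek ej => [ab|ab|->] ek ej; last by rewrite ek ej.
  by have := leq_mul ab (leqnn N); rewrite mulSn; lia.
by have := leq_mul ab (leqnn N); rewrite mulSn; lia.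
Qed.

Lemma card_cyc : #|cyc| = N.
Proof.
rewrite /cyc cardsE; have /card_uniqP -> : uniq [seq g i | i <- iota 0 N].
  rewrite map_inj_in_uniq ?iota_uniq // => i j; rewrite !mem_iota => /andP [_ iN] /andP [_ jN]; exact: g_inj.
by rewrite size_map size_iota.
Qed.

Definition off_cycle (q : seq V) := uniq q && all (fun x => x \notin cyc) q.

Lemma path_up i k : path e (g i) [seq g l | l <- iota i.+1 k].
Proof. by elim: k i => [|k IHk] i //=; rewrite g_edge IHk. Qed.

Lemma last_up i k : last (g i) [seq g l | l <- iota i.+1 k] = g (i + k).
Proof. by elim: k i => [|k IHk] i /=; rewrite ?addn0 // IHk addSnnS. Qed.

Lemma path_down i k : path e (g (i + k)) (rev [seq g l | l <- iota i k]).
Proof.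
elim: k i => [|k IHk] i //=; rewrite rev_cons rcons_path addnS -addSn IHk /=.
case: k {IHk} => [|k] /=; first by rewrite addn0 e_sym.
by rewrite rev_cons last_rcons e_sym.
Qed.

Lemma last_down i k : last (g (i + k)) (rev [seq g l | l <- iota i k]) = g i.
Proof. by case: k => [|k] /=; rewrite ?addn0 // rev_cons last_rcons. Qed.

(** The length comparison behind all exchanges: listing the kept cycle vertices by indices L inside
    one period turns their distinctness into a statement about indices. *)
Lemma cycle_bound i q L c : perm_eq c (q ++ map g L) -> off_cycle q -> uniq L ->
  all (fun k => i <= k < i + N) L -> cycle e c -> size q + size L <= N.
Proof.
move=> pc /andP [uq qC] uL Lw cc.
rewrite -(size_map g L) -size_cat -(perm_size pc); apply: cycle_le => //.
rewrite (perm_uniq pc) cat_uniq uq map_inj_in_uniq ?uL ?andbT /=; last first.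
  by move=> x y /(allP Lw) xw /(allP Lw) yw; apply: g_window xw yw.
apply/hasPn => x /mapP [k _ ->]; apply: contraTN (mem_cyc k).
exact: (allP qC).
Qed.

(* The new cycle is [g i] q [g (i + s + a)], backwards to [g (i + s)], then r, then
   [g (i + s + a + t)] forwards to [g i]: q and r replace two arcs with s and t edges. *)
Lemma exchange_chord i s a t b q r : s + a + t + b = N -> 0 < s -> 0 < t -> 0 < b ->
  off_cycle (q ++ r) -> path e (g i) (rcons q (g (i + s + a))) ->
  path e (g (i + s)) (rcons r (g (i + s + a + t))) -> size q + size r + 2 <= s + t.
Proof.
move=> eN s0 t0 b0 off pq pr.
pose L := i :: iota (i + s) a.+1 ++ iota (i + s + a + t) b.
pose c := g i :: rcons q (g (i + s + a)) ++ rev [seq g l | l <- iota (i + s) a] ++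
  rcons r (g (i + s + a + t)) ++ [seq g l | l <- iota (i + s + a + t).+1 b.-1].
have : size (q ++ r) + size L <= N.
  apply: (@cycle_bound i _ _ c) => //.
  - rewrite /c /L.
    rewrite (iota_head _ b0) iota_last /= !map_cat /= map_rcons -!cats1.
    by apply/permP => p; rewrite /= !count_cat /= ?count_cat /= ?count_rev !addn0; count_lia.
  - rewrite /L cons_uniq cat_uniq !iota_uniq mem_cat !mem_iota andbT.
    apply/andP; split; first by apply/norP; split; lia.
    by apply/hasPn => x; rewrite !mem_iota; lia.
  - by apply/allP => x; rewrite /L in_cons mem_cat !mem_iota; lia.
  - rewrite /c /= !rcons_cat cat_path pq last_rcons cat_path path_down last_down.
    rewrite cat_path pr last_rcons /= rcons_path path_up last_up /=.
    rewrite -(g_per i) (_ : i + N = (i + s + a + t + b.-1).+1) ?g_edge //; lia.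
by rewrite /L /= !size_cat !size_iota; lia.
Qed.

(** The new cycle is [g i], q, [g (i + a + t)] forwards to [g (i + a + t + b)], r, then [g (i + a)]
    backwards to [g i.+1] and the edge to [g i]. The dropped arcs have t and s edges. *)
Lemma exchange_chord_rev i s a t b q r : a + t + b + s = N -> 0 < s -> 0 < t -> 0 < a ->
  off_cycle (q ++ r) -> path e (g i) (rcons q (g (i + a + t))) ->
  path e (g (i + a + t + b)) (rcons r (g (i + a))) -> size q + size r + 2 <= s + t.
Proof.
move=> eN s0 t0 a0 off pq pr.
pose L := i :: iota (i + a + t) b.+1 ++ iota i.+1 a.
pose c := g i :: rcons q (g (i + a + t)) ++ [seq g l | l <- iota (i + a + t).+1 b] ++
  rcons r (g (i + a)) ++ rev [seq g l | l <- iota i.+1 a.-1].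
have : size (q ++ r) + size L <= N.
  apply: (@cycle_bound i _ _ c) => //.
  - rewrite /c /L.
    have -> : iota i.+1 a = rcons (iota i.+1 a.-1) (i + a).
      by rewrite -[in LHS](prednK a0) iota_last; congr rcons; lia.
    rewrite /= !map_cat /= map_rcons -!cats1.
    by apply/permP => p; rewrite /= !count_cat /= ?count_cat /= ?count_rev !addn0; count_lia.
  - rewrite /L cons_uniq cat_uniq !iota_uniq mem_cat !mem_iota andbT.
    apply/andP; split; first by apply/norP; split; lia.
    by apply/hasPn => x; rewrite !mem_iota; lia.
  - by apply/allP => x; rewrite /L in_cons mem_cat !mem_iota; lia.
  - rewrite /c /= !rcons_cat cat_path pq last_rcons cat_path path_up last_up.
    rewrite cat_path pr last_rcons /= rcons_path (_ : i + a = i.+1 + a.-1); last lia.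
    by rewrite path_down last_down e_sym g_edge.
by rewrite /L /= !size_cat !size_iota; lia.
Qed.

(** Here q replaces an arc with a - 1 inner vertices. *)
Lemma exchange_arc i a q : 0 < a < N -> off_cycle q ->
  path e (g i) (rcons q (g (i + a))) -> size q < a.
Proof.
move=> aN off pq; pose b := N - a.
pose L := i :: iota (i + a) b.
pose c := g i :: rcons q (g (i + a)) ++ [seq g l | l <- iota (i + a).+1 b.-1].
have : size q + size L <= N.
  apply: (@cycle_bound i _ _ c) => //.
  - rewrite /c /L.
    rewrite (@iota_head _ b) /=; last by rewrite /b; lia.
    rewrite -!cats1.
    by apply/permP => p; rewrite /= !count_cat /= ?count_cat /= !addn0; count_lia.
  - by rewrite /L cons_uniq !iota_uniq !mem_iota andbT; lia.
  - by apply/allP => x; rewrite /L in_cons mem_iota /b; lia.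
  - rewrite /c /= !rcons_cat cat_path pq last_rcons rcons_path path_up last_up /=.
    rewrite -(g_per i) (_ : i + N = (i + a + b.-1).+1) ?g_edge // /b; lia.
by rewrite /L /= size_iota /b; lia.
Qed.

(** The cycle [g i], q, [g (i + a + b + 2)] backwards to [g (i + a + 2)], [g i.+1] forwards to
    [g (i + a + 1)], [g (i + a + b + 3)] forwards to [g i] keeps every vertex of C and adds q. *)
Lemma exchange_crossing i a b c0 q : a + b + c0 + 3 = N -> 0 < c0 -> off_cycle q ->
  path e (g i) (rcons q (g (i + a + b + 2))) -> 0 < size q ->
  e (g i.+1) (g (i + a + 2)) -> e (g (i + a + 1)) (g (i + a + b + 3)) -> False.
Proof.
move=> eN c0_gt0 off pq q0 e1 e2.
pose L := i :: iota i.+1 a.+1 ++ iota (i + a + 2) b.+1 ++ iota (i + a + b + 3) c0.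
pose c := g i :: rcons q (g (i + a + b + 2)) ++ rev [seq g l | l <- iota (i + a + 2) b] ++
  (g i.+1 :: [seq g l | l <- iota i.+2 a]) ++
  g (i + a + b + 3) :: [seq g l | l <- iota (i + a + b + 3).+1 c0.-1].
have : size q + size L <= N.
  apply: (@cycle_bound i _ _ c) => //.
  - rewrite /c /L.
    rewrite (iota_head _ c0_gt0) (iota_last (i + a + 2)) (_ : i + a + 2 + b = i + a + b + 2); last lia.
    rewrite /= !map_cat /= map_rcons -!cats1.
    by apply/permP => p; rewrite /= !count_cat /= ?count_cat /= ?count_rev !addn0; count_lia.
  - rewrite /L cons_uniq !cat_uniq !iota_uniq !mem_cat !mem_iota andbT.
    apply/and4P; split => //.
    + by apply/norP; split; [lia | apply/norP; split; lia].
    + by apply/hasPn => x; rewrite mem_cat !mem_iota; lia.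
    + by apply/hasPn => x; rewrite !mem_iota; lia.
  - apply/allP => x; rewrite /L in_cons !mem_cat !mem_iota; lia.
  - rewrite /c /= !rcons_cat cat_path pq last_rcons cat_path.
    rewrite (_ : i + a + b + 2 = i + a + 2 + b) ?path_down ?last_down; last lia.
    rewrite rcons_cons rcons_cat /= (e_sym (g (i + a + 2))) e1 cat_path path_up last_up /=.
    rewrite addSn -addn1 e2 rcons_path path_up last_up /=.
    rewrite -(g_per i) (_ : i + N = (i + a + b + 3 + c0.-1).+1) ?g_edge //; lia.
by rewrite /L /= !size_cat /= !size_cat /= !size_iota; lia.
Qed.

(** Here and in the next two lemmas the exchange is expressed by positions instead of arc
    lengths. *)
Lemma exchange_chord_at i j k l q r : i < k <= j -> j < l < i + N -> off_cycle (q ++ r) ->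
  path e (g i) (rcons q (g j)) -> path e (g k) (rcons r (g l)) ->
  size q + size r + 2 <= (k - i) + (l - j).
Proof.
move=> ikj jl off; have [a ej] : exists a, j = k + a by exists (j - k); lia.
have [s ek] : exists s, k = i + s by exists (k - i); lia.
have [t el] : exists t, l = j + t by exists (l - j); lia.
move: ikj jl; rewrite {l}el {j}ej {k}ek => ikj jl pq pr.
have := @exchange_chord i s a t (N - (s + a + t)) q r; rewrite !addKn; apply=> //; lia.
Qed.

Lemma exchange_chord_rev_at i j k l q r : i < l < j -> j <= k < i + N -> off_cycle (q ++ r) ->
  path e (g i) (rcons q (g j)) -> path e (g k) (rcons r (g l)) ->
  size q + size r + 2 <= (j - l) + (i + N - k).
Proof.
move=> ilj jk off; have [a el] : exists a, l = i + a by exists (l - i); lia.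
have [t ej] : exists t, j = l + t by exists (j - l); lia.
have [b ek] : exists b, k = j + b by exists (k - j); lia.
move: ilj jk; rewrite {k}ek {j}ej {l}el => ilj jk pq pr.
have := @exchange_chord_rev i (i + N - (i + a + t + b)) a t b q r.
by rewrite addKn [t + _]addnC; apply=> //; lia.
Qed.

Lemma exchange_crossing_at i j k q : i < k < j -> j.+1 < i + N -> off_cycle q ->
  path e (g i) (rcons q (g j)) -> 0 < size q ->
  e (g i.+1) (g k.+1) -> e (g k) (g j.+1) -> False.
Proof.
move=> ikj jN off; have [b ej] : exists b, j = (k + b).+1 by exists (j - k.+1); lia.
have [a ek] : exists a, k = (i + a).+1 by exists (k - i.+1); lia.
move: ikj jN; rewrite {j}ej {k}ek => ikj jN pq q0 e1 e2.
apply: (@exchange_crossing i a b (N - (a + b + 3)) q) => //; rewrite ?addn3 ?addn2 ?addn1 //; lia.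
Qed.

End LongestCycle.

(** * Dominating longest cycles *)

Section DominatingCycle.
Variables (V : finType) (e : rel V).
Hypotheses (e_sym : symmetric e) (e_irr : irreflexive e).
Variables (N : nat) (g : nat -> V).
Hypothesis cC : longest_cycle e N g.
Let N_gt2 : 2 < N. Proof. by case: cC. Qed.
Let g_per i : g (i + N) = g i. Proof. by case: cC. Qed.
Local Notation C := (cyc N g).

Definition nxt x := g (index x [seq g i | i <- iota 0 N]).+1.
(** Adding N - 1 stands for subtracting 1, which would truncate at index 0. *)
Definition prv x := g (index x [seq g i | i <- iota 0 N] + N.-1).

Lemma g_shift i j k : g i = g j -> g (i + k) = g (j + k).
Proof.
have N0 : 0 < N by nat_lia.
rewrite -(g_mod cC i) -(g_mod cC j) => eg.
have eqm : i %% N = j %% N by case: cC => _ _ _ inj _; apply: inj eg; rewrite ltn_mod.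
by rewrite -(g_mod cC) -modnDml eqm modnDml (g_mod cC).
Qed.

Lemma g_index x : x \in C -> g (index x [seq g i | i <- iota 0 N]) = x.
Proof.
rewrite inE => xC; have lt : index x [seq g i | i <- iota 0 N] < N.
  by move: xC; rewrite -index_mem size_map size_iota.
by have := nth_index (g 0) xC; rewrite (nth_map 0) ?size_iota // nth_iota.
Qed.

Lemma nxt_g i : nxt (g i) = g i.+1.
Proof.
have e1 := g_index (mem_cyc cC i).
by rewrite /nxt -addn1 (g_shift 1 e1) addn1.
Qed.

Lemma prv_g i : prv (g i.+1) = g i.
Proof.
have e1 := g_index (mem_cyc cC i.+1).
by rewrite /prv (g_shift _ e1) addSnnS prednK ?g_per //; nat_lia.
Qed.

Lemma g_of x : x \in C -> exists i, x = g i.+1.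
Proof.
move=> xC; have [k k1 ->] := cycP cC xC 1.
by exists k.-1; rewrite prednK //; nat_lia.
Qed.

Lemma nxtK x : x \in C -> prv (nxt x) = x.
Proof. by case/g_of => i ->; rewrite nxt_g prv_g. Qed.

Lemma prvK x : x \in C -> nxt (prv x) = x.
Proof. by case/g_of => i ->; rewrite prv_g nxt_g. Qed.

Lemma nxt_cyc x : nxt x \in C. Proof. exact: (mem_cyc cC). Qed.
Lemma prv_cyc x : prv x \in C. Proof. exact: (mem_cyc cC). Qed.

Lemma nxt_inj : {in C &, injective nxt}.
Proof. by move=> x y xC yC /(congr1 prv); rewrite !nxtK. Qed.

Lemma prv_inj : {in C &, injective prv}.
Proof. by move=> x y xC yC /(congr1 nxt); rewrite !prvK. Qed.

Lemma nxt_edge x : x \in C -> e x (nxt x).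
Proof. by case/g_of => i ->; rewrite nxt_g; case: cC. Qed.

Lemma prv_edge x : x \in C -> e x (prv x).
Proof. by case/g_of => i ->; rewrite prv_g e_sym; case: cC. Qed.

Lemma g_pair x y : x \in C -> y \in C -> x != y ->
  exists i a, [/\ x = g i.+1, y = g (i.+1 + a) & 0 < a < N].
Proof.
move=> /g_of [i ->] yC; have [k ik ->] := cycP cC yC i.+1 => neq.
exists i, (k - i.+1); split=> //; first by congr g; nat_lia.
have : k != i.+1 by apply: contraNneq neq => ->.
nat_lia.
Qed.

Lemma off1 u : u \notin C -> off_cycle N g [:: u].
Proof. by move=> uC; rewrite /off_cycle /= uC. Qed.

Lemma off2 u v : u \notin C -> v \notin C -> u != v -> off_cycle N g [:: u; v].
Proof. by move=> uC vC uv; rewrite /off_cycle /= inE uC vC uv. Qed.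

(** Otherwise u could be inserted between x and its successor. *)
Lemma no_consecutive u x : u \notin C -> x \in C -> e u x -> ~~ e u (nxt x).
Proof.
move=> uC /g_of [i ->]; rewrite nxt_g => ui; apply/negP => ui'.
have := @exchange_arc _ e N g cC i.+1 1 [:: u] _ (off1 uC).
rewrite /= (e_sym _ u) ui addn1 ui'; nat_lia.
Qed.

(** The detour through u and an edge between the successors would replace two cycle edges and add u
    to the cycle. *)
Lemma nxt_indep u x w : u \notin C -> x \in C -> w \in C -> x != w ->
  e u x -> e u w -> ~~ e (nxt x) (nxt w).
Proof.
move=> uC xC wC xw ux uw; have [i [a [ex ew aN]]] := g_pair xC wC xw.
have aN1 : a.+1 != N.
  (* In this case x is the successor of w, and u would have two consecutive neighbours. *)
  apply: contraTneq ux => eN; rewrite ex -g_per addSn -addnS -eN addnS.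
  by rewrite -addSn -(addn1 a) addnA addn1 -nxt_g -ew no_consecutive.
apply/negP; rewrite ex ew !nxt_g => xwe.
have := @exchange_chord _ e e_sym N g cC i.+1 1 a.-1 1 (N - a.+1) [:: u] [::].
rewrite /= (_ : i.+1 + 1 + a.-1 = i.+1 + a) ?addn1; last nat_lia.
rewrite -ew -ex (e_sym x) ux uw xwe.
move/(_ _ isT isT _ (off1 uC) isT isT); nat_lia.
Qed.

Lemma prv_indep u x w : u \notin C -> x \in C -> w \in C -> x != w ->
  e u x -> e u w -> ~~ e (prv x) (prv w).
Proof.
move=> uC xC wC xw ux uw; have [i [a [ex ew aN]]] := g_pair xC wC xw.
have a1 : a != 1.
  apply: contraTneq uw => ea; rewrite ew ea addn1 -nxt_g -ex no_consecutive //.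
apply/negP; rewrite ex ew addSn !prv_g => xwe.
have := @exchange_chord_rev _ e e_sym N g cC i.+1 1 a.-1 1 (N - a.+1) [:: u] [::].
rewrite /= (_ : i.+1 + a.-1 + 1 = i.+1 + a); last nat_lia.
rewrite (_ : i.+1 + a + (N - a.+1) = i + N) ?g_per; last nat_lia.
rewrite (_ : i.+1 + a.-1 = i + a); last nat_lia.
rewrite -ew -ex (e_sym x) ux uw xwe.
move/(_ _ isT isT _ (off1 uC) isT isT); nat_lia.
Qed.

(** Detours through u and v would replace two cycle edges and add two vertices. *)
Lemma no_two_crossings u v x w : u \notin C -> v \notin C -> u != v -> x \in C -> w \in C ->
  x != w -> e u x -> e u w -> e v (nxt x) -> e v (nxt w) -> False.
Proof.
move=> uC vC uv xC wC xw ux uw; have [i [a [ex ew aN]]] := g_pair xC wC xw.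
have aN1 : a.+1 != N.
  apply: contraTneq ux => eN; rewrite ex -g_per addSn -addnS -eN addnS.
  by rewrite -addSn -(addn1 a) addnA addn1 -nxt_g -ew no_consecutive.
rewrite ex ew !nxt_g => vx vw.
have := @exchange_chord _ e e_sym N g cC i.+1 1 a.-1 1 (N - a.+1) [:: u] [:: v].
rewrite /= (_ : i.+1 + 1 + a.-1 = i.+1 + a) ?addn1; last nat_lia.
rewrite -ew -ex (e_sym x) ux uw (e_sym _ v) vx vw.
move/(_ _ isT isT _ (off2 uC vC uv) isT isT); nat_lia.
Qed.

(** The detours would drop only [nxt w] and add both u and v. *)
Lemma no_long_crossing u v x w : u \notin C -> v \notin C -> u != v -> x \in C -> w \in C ->
  e u x -> e u w -> e v (nxt x) -> e v (nxt (nxt w)) -> False.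
Proof.
move=> uC vC uv xC wC ux uw vx; have [<-|xw] := eqVneq x w.
  by apply/negP/no_consecutive => //; apply: nxt_cyc.
have [i [a [ex ew aN]]] := g_pair xC wC xw.
have aN1 : a.+1 != N.
  apply: contraTneq ux => eN; rewrite ex -g_per addSn -addnS -eN addnS.
  by rewrite -addSn -(addn1 a) addnA addn1 -nxt_g -ew no_consecutive.
have [eN|aN2] := eqVneq a.+2 N.
  rewrite ew !nxt_g (_ : (i.+1 + a).+2 = i.+1 + N) ?g_per; last nat_lia.
  by rewrite -ex => /(no_consecutive vC xC); rewrite vx.
move: vx; rewrite ex ew !nxt_g => vx vw.
have := @exchange_chord _ e e_sym N g cC i.+1 1 a.-1 2 (N - a.+2) [:: u] [:: v].
rewrite /= (_ : i.+1 + 1 + a.-1 = i.+1 + a) ?addn1 ?addn2; last nat_lia.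
rewrite -ew -ex (e_sym x) ux uw (e_sym _ v) vx vw.
move/(_ _ isT isT _ (off2 uC vC uv) isT isT); nat_lia.
Qed.

Variable d : nat.
Hypothesis d_gt0 : 0 < d.
Hypotheses (deg_ge : forall x, d <= #|nbrs e x|).
Hypothesis leafb : forall S, conn_set e S -> #|bnd e S| < 2 * d.
Hypothesis out_indep : forall x y, x \notin C -> y \notin C -> ~~ e x y.
Hypotheses (order : #|V| <= 3 * d) (N_le : N + 2 <= #|V|).

Lemma nbrs_cyc u x : u \notin C -> x \in nbrs e u -> x \in C.
Proof. by rewrite in_nbrs => uC; apply: contraTT => xC; apply: out_indep. Qed.

Lemma card_sub_cyc (A : {set V}) : (forall x, x \in A -> x \in C) -> #|A| <= N.
Proof. by move=> AC; rewrite -(card_cyc cC); apply/subset_leq_card/subsetP. Qed.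

(* Otherwise N(u) and the first and second predecessors of N(v) meet in x only, so N >= 3d - 1. *)
Lemma no_crossing u v x : u \notin C -> v \notin C -> u != v ->
  x \in C -> e u x -> ~~ e v (nxt x).
Proof.
move=> uC vC uv xC ux; apply/negP => vx.
pose A := nbrs e u; pose B := nbrs e v; pose B1 := prv @: B; pose B2 := prv @: B1.
have AC y : y \in A -> y \in C by apply: nbrs_cyc.
have BC y : y \in B -> y \in C by apply: nbrs_cyc.
have B1C y : y \in B1 -> y \in C by case/imsetP => z _ ->; apply: prv_cyc.
have B2C y : y \in B2 -> y \in C by case/imsetP => z _ ->; apply: prv_cyc.
have inB1 y : y \in B1 -> e v (nxt y).
  by case/imsetP => z zB ->; rewrite prvK ?BC // -in_nbrs.
have inB2 y : y \in B2 -> e v (nxt (nxt y)).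
  by case/imsetP => z zB ->; rewrite prvK ?B1C // inB1.
have cB1 : #|B1| = #|B|.
  by apply: card_in_imset => y z yB zB; apply: prv_inj; apply: BC.
have cB2 : #|B2| = #|B1|.
  by apply: card_in_imset => y z yB zB; apply: prv_inj; apply: B1C.
have dis12 : B1 :&: B2 = set0.
  apply/setP => y; rewrite in_set0 in_setI; apply/negP => /andP [y1 y2].
  have := no_consecutive vC (nxt_cyc y) (inB1 y y1); by rewrite inB2.
have disA12 : A :&: (B1 :|: B2) \subset [set x].
  apply/subsetP => y; rewrite in_setI in_setU in_set1 in_nbrs => /andP [uy /orP [y1|y2]].
    have [//|yx] := eqVneq y x.
    by case: (@no_two_crossings u v y x) => //; [apply: B1C | apply: inB1].
  by case: (@no_long_crossing u v x y) => //; [apply: B2C | apply: inB2].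
have : #|A :|: (B1 :|: B2)| <= N.
  by apply: card_sub_cyc => y; rewrite !in_setU => /or3P []; auto.
have := subset_leq_card disA12; rewrite cards1 !cardsU dis12 cards0.
have := deg_ge u; have := deg_ge v; rewrite -/A -/B; nat_lia.
Qed.

(** Otherwise N(u), N(v) and the successors of N(v) are pairwise disjoint subsets of C by
    [no_crossing], so N is at least 3 * d. *)
Lemma common_nbr u v : u \notin C -> v \notin C -> u != v -> nbrs e v :&: nbrs e u != set0.
Proof.
move=> uC vC uv; apply/negP => /eqP dis.
pose B1 := nxt @: nbrs e v.
have BC y : y \in nbrs e v -> y \in C by apply: nbrs_cyc.
have cB1 : #|B1| = #|nbrs e v|.
  by apply: card_in_imset => y z yB zB; apply: nxt_inj; apply: BC.
have dis1 : (nbrs e v :|: nbrs e u) :&: B1 = set0.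
  apply/setP => y; rewrite in_set0 in_setI in_setU !in_nbrs; apply/negP.
  case/andP=> yuv /imsetP [z zB eyz]; move: yuv; rewrite eyz.
  have zC := BC z zB; rewrite in_nbrs in zB.
  by rewrite (negbTE (no_consecutive vC zC zB)) (negbTE (no_crossing vC uC _ zC zB)) // eq_sym.
have : #|(nbrs e v :|: nbrs e u) :|: B1| <= N.
  apply: card_sub_cyc => y; rewrite !in_setU -orbA => /or3P [|| /imsetP [z _ ->]]; last exact: nxt_cyc.
    exact: BC.
  exact: nbrs_cyc.
rewrite cardsU dis1 cardsU dis cards0.
have := deg_ge u; have := deg_ge v; nat_lia.
Qed.

Lemma dominating_cycle_contra : False.
Proof.
have cardCC : #|~: C| = #|V| - N.
  by have := cardsC C; rewrite (card_cyc cC); nat_lia.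
have [u uC] : exists u, u \in ~: C by apply/set0Pn; rewrite -card_gt0; nat_lia.
have R0 : ~: C :\ u != set0.
  by rewrite -card_gt0; have := cardsD1 u (~: C); rewrite uC; nat_lia.
rewrite in_setC in uC.
have AC y : y \in nbrs e u -> y \in C by apply: nbrs_cyc.
have UA y : y \in nbrs e u -> e u y by rewrite in_nbrs.
have inR v : v \in ~: C :\ u -> v \notin C /\ u != v.
  by rewrite in_setD1 in_setC eq_sym => /andP [].
pose P1 := nxt @: nbrs e u; pose P2 := prv @: nbrs e u.
have PC y : y \in P1 :|: P2 -> y \in C.
  by rewrite in_setU => /orP [] /imsetP [w _ ->]; [apply: nxt_cyc | apply: prv_cyc].
have nP w : w \in nbrs e u -> ~~ e u (nxt w).
  by move=> wA; apply: no_consecutive (AC w wA) (UA w wA).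
have nP' w : w \in nbrs e u -> ~~ e u (prv w).
  move=> wA; apply/negP => /(no_consecutive uC (prv_cyc w)).
  by rewrite prvK ?AC // UA.
apply: (@star_dominating V e d e_sym e_irr deg_ge leafb u (~: C :\ u) P1 P2)
  => //; try by [].
- by apply: contra uC => /PC.
- by rewrite in_setD1 eqxx.
- apply/pred0P => y /=; apply/negP => /andP [+ yA]; rewrite in_nbrs in yA.
  by rewrite in_setU => /orP [] /imsetP [w wA eyw]; move: yA; apply/negP; rewrite eyw; auto.
- by apply/pred0P => y /=; apply/negP => /andP [/inR [yC _] /AC]; apply/negP.
- by apply/pred0P => y /=; apply/negP => /andP [/inR [yC _] /PC]; apply/negP.
- by move=> v w /inR [vC _] /inR [wC _]; apply: out_indep.
- move=> v y /inR [vC uv]; rewrite in_setU => /orP [] /imsetP [w wA ->].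
    by apply: (no_crossing uC vC uv (AC w wA) (UA w wA)).
  apply/negP => /(no_crossing vC uC); rewrite eq_sym uv prv_cyc => /(_ isT isT).
  by rewrite prvK ?AC // UA.
- by move=> v /inR [vC uv]; apply: common_nbr.
- by move=> x y /AC xC /AC yC; apply: nxt_inj.
- by move=> x y /AC xC /AC yC; apply: prv_inj.
- by move=> w /AC; apply: nxt_edge.
- by move=> w /AC; apply: prv_edge.
- move=> _ _ /imsetP [x xA ->] /imsetP [w wA ->]; have [->|xw] := eqVneq x w; first by rewrite e_irr.
  by apply: (@nxt_indep u); auto.
- move=> _ _ /imsetP [x xA ->] /imsetP [w wA ->]; have [->|xw] := eqVneq x w; first by rewrite e_irr.
  by apply: (@prv_indep u); auto.
(* If A has the same successors as predecessors, A and its successors alternate along the cycle and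
   cover it. *)
move=> eP; apply/setP => y; rewrite in_set0; apply/negbTE.
rewrite in_setC negbK !in_setU in_set1 in_setD1 in_setC.
have [yC|yC] := boolP (y \in C); last by case: (y == u); rewrite ?orbT.
have [w wA] : exists w, w \in nbrs e u.
  by apply/set0Pn; rewrite -card_gt0; apply: leq_trans (deg_ge u).
have [i ew] := g_of (AC w wA).
have step k : (g (i.+1 + k) \in nbrs e u) || (g (i.+1 + k) \in P1).
  elim: k => [|k]; first by rewrite addn0 -ew wA.
  case/orP=> [gA|]; first by rewrite addnS -nxt_g [in X in _ || X]imset_f ?orbT.
  rewrite eP => /imsetP [w' w'A eg].
  by rewrite addnS -nxt_g eg prvK ?AC // w'A.
have [k ik ->] := cycP cC yC i.+1.
by have := step (k - i.+1); rewrite subnKC; [case/orP => ->; rewrite ?orbT | nat_lia].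
Qed.

End DominatingCycle.

(** * Paths outside a longest cycle *)

Section OffCyclePaths.
Variables (V : finType) (e : rel V).
Hypotheses (e_sym : symmetric e) (e_irr : irreflexive e).
Variables (N : nat) (g : nat -> V).
Hypothesis cC : longest_cycle e N g.
Local Notation C := (cyc N g).

Definition off_path (q : seq V) := off_cycle N g q && sorted e q.

Definition attach x := nbrs e x :&: C.

Lemma path_rcons_rev x p y : path e y (rcons (rev p) x) = path e x (rcons p y).
Proof.
have := rev_path e x (rcons p y); rewrite last_rcons belast_rcons rev_cons => ->.
by apply: eq_path => a b; rewrite e_sym.
Qed.

Lemma off_path_rev q : off_path q -> off_path (rev q).
Proof.
rewrite /off_path /off_cycle rev_uniq all_rev rev_sorted.
by rewrite (eq_sorted (e' := e)) // => x y; rewrite e_sym.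
Qed.

Lemma off_pathP q x : off_path q -> x \in q -> x \notin C.
Proof. by case/andP => /andP [_ /allP qC] _; apply: qC. Qed.

Lemma off_path_uniq q : off_path q -> uniq q.
Proof. by case/andP => /andP []. Qed.

Lemma attach_gap x q i a : off_path (x :: q) -> 0 < a < N ->
  g i \in attach x -> g (i + a) \in attach (last x q) -> (size q).+1 < a.
Proof.
move=> offq aN; rewrite !in_setI !in_nbrs => /andP [xi _] /andP [la _].
have := @exchange_arc _ e N g cC i a (x :: q) aN.
have /andP [oq pq] := offq.
by apply => //=; rewrite e_sym xi rcons_path; move: pq => /= ->.
Qed.

Lemma attach_gap_rev x q i a : off_path (x :: q) -> 0 < a < N ->
  g i \in attach (last x q) -> g (i + a) \in attach x -> (size q).+1 < a.
Proof.
move=> offq aN; have := off_path_rev offq; rewrite lastI rev_rcons => offr l1 x1.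
have := @attach_gap _ _ i a offr aN l1; rewrite size_rev size_belast; apply.
by case: q {offq aN offr l1} => //= y q; rewrite rev_cons last_rcons.
Qed.

(** A rotation of the path: go from h back to x, then jump to the vertex after h and continue. The
    end changes only if h was the end, and then it becomes x. *)
Lemma rotate_path x q h : off_path (x :: q) -> (forall z, z \in q -> e x z) ->
  h \in x :: q -> exists s, [/\ off_path (h :: s), h :: s =i x :: q, size s = size q
    & last h s = last x q \/ last h s = x].
Proof.
move=> offq xq; rewrite inE => /orP [/eqP ->|hq]; first by exists q; split=> //; left.
have [a [b eq]] : exists a b, q = a ++ h :: b.
  by case/splitPr: hq => a b; exists a, b.
have perm2 : perm_eq (h :: rev (x :: a) ++ b) (x :: q).
  by apply/permP => p; rewrite eq /= !count_cat /= count_rev /=; count_lia.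
have mem2 := perm_mem perm2.
exists (rev (x :: a) ++ b); have [/andP [uq Cq] pq] := andP offq; split=> //.
- apply/andP; split; first (apply/andP; split).
  + by rewrite (perm_uniq perm2).
  + by apply/allP => z; rewrite mem2 => /(allP Cq).
  rewrite /= cat_path rev_cons last_rcons.
  move: pq; rewrite eq /= cat_path /= => /and3P [pa lh pb].
  rewrite path_rcons_rev rcons_path pa lh /=;  case: b pb eq {mem2 perm2} => //= y b /andP [_ ->] eq.
  by rewrite xq ?andbT // eq !(mem_cat, inE) eqxx !orbT.
- by rewrite eq !size_cat size_rev /= addSnnS.
- rewrite last_cat rev_cons last_rcons eq last_cat /=.
  by case: b {mem2 perm2 eq} => [|y b]; [right | left].
Qed.


Let mem_g i : g i \in C. Proof. exact: (mem_cyc cC). Qed.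
Let g_per i : g (i + N) = g i. Proof. by case: cC. Qed.
Let N_gt2 : 2 < N. Proof. by case: cC. Qed.

(* Shifting the neighbours of [g i.+1] (resp. [g (i + m).+1]) back by one on the arc
   following it makes the two neighbourhoods disjoint. *)
Lemma crossing_count i m h p (H : {set V}) : off_path (h :: p) -> 1 < m -> m.+1 < N ->
  e (g i) h -> e (last h p) (g (i + m)) -> (forall z, z \in h :: p -> z \in H) ->
  (forall z, z \in H -> z \notin C) ->
  (forall z, z \in H -> ~~ e (g i.+1) z) -> (forall z, z \in H -> ~~ e (g (i + m).+1) z) ->
  #|nbrs e (g i.+1)| + #|nbrs e (g (i + m).+1)| + #|H| <= #|V|.
Proof.
move=> offp m1 mN xh lx pH HC y1H y2H.
have /andP [oq pq] := offp.
have pq' : path e (g i) (rcons (h :: p) (g (i + m))) by rewrite /= xh rcons_path; move: pq => /= ->.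
have pr' : path e (g (i + m)) (rcons (rev (h :: p)) (g i)) by rewrite path_rcons_rev.
have oqr : off_cycle N g (rev (h :: p)) by case/andP: (off_path_rev offp).
pose I1 := [set z in [seq g k | k <- iota i.+1 m]].
have in_arc z : z \in C -> exists k, [/\ z = g k, i < k <= i + N & (z \in I1) = (k <= i + m)].
  move=> zC; have [k ik ->] := cycP cC zC i.+1; exists k; split=> //.
  rewrite in_set; apply/mapP/idP => [[l]|le]; last by exists k; rewrite // mem_iota; nat_lia.
  rewrite mem_iota => il /(g_window cC) eq; rewrite (eq i.+1) //; nat_lia.
pose phi1 z := if z \in I1 then prv N g z else z.
pose phi2 z := if z \in C :\: I1 then prv N g z else z.
pose y1 := g i.+1; pose y2 := g (i + m).+1.
have I1C z : z \in I1 -> z \in C by rewrite in_set => /mapP [k _ ->].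
have prv1 z : z \in I1 -> e y1 z -> exists k, [/\ z = g k.+1, prv N g z = g k, g k \in I1 & i < k < i + m].
  move=> zI ez; have [[|k] [eq ik zk]] := in_arc z (I1C z zI); first by nat_lia.
  have le : k < i + m by rewrite -zk.
  exists k; split=> //; first by rewrite eq (prv_g cC).
    rewrite in_set; apply/mapP; exists k => //; rewrite mem_iota.
    have : k != i by apply: contraTneq ez => ek; rewrite eq ek e_irr.
    nat_lia.
  have : k != i by apply: contraTneq ez => ek; rewrite eq ek e_irr.
  nat_lia.
have prv2 z : z \in C :\: I1 -> e y2 z ->
    exists k, [/\ z = g k.+1, prv N g z = g k, g k \in C :\: I1 & i + m < k < i + N].
  move=> /setDP [zC zI] ez; have [[|k] [eq ik zk]] := in_arc z zC; first by nat_lia.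
  have neq : k != i + m by apply: contraTneq ez => ek; rewrite eq ek e_irr.
  have lt : i + m < k by rewrite ltn_neqAle eq_sym neq leqNgt -zk.
  exists k; split=> //; first by rewrite eq (prv_g cC).
    rewrite in_setD mem_g andbT in_set; apply/negP => /mapP [l].
    rewrite mem_iota => il /(g_window cC) ekl.
    have : k = l by apply: (ekl i.+1); nat_lia.
    nat_lia.
  nat_lia.
have inj1 : {in nbrs e y1 &, injective phi1}.
  move=> z z'; rewrite !in_nbrs /phi1 => ez ez'; case: ifP => zI; case: ifP => zI' //.
  - by apply: (prv_inj cC); apply: I1C.
  - by have [k [_ -> kI _]] := prv1 z zI ez => ek; rewrite -ek kI in zI'.
  - by have [k [_ -> kI _]] := prv1 z' zI' ez' => ek; rewrite ek kI in zI.
have inj2 : {in nbrs e y2 &, injective phi2}.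
  move=> z z'; rewrite !in_nbrs /phi2 => ez ez'; case: ifP => zI; case: ifP => zI' //.
  - by apply: (prv_inj cC); [case/setDP: zI | case/setDP: zI'].
  - by have [k [_ -> kI _]] := prv2 z zI ez => ek; rewrite -ek kI in zI'.
  - by have [k [_ -> kI _]] := prv2 z' zI' ez' => ek; rewrite ek kI in zI.
have dis : phi1 @: nbrs e y1 :&: phi2 @: nbrs e y2 = set0.
  apply/setP => w; rewrite in_set0 in_setI; apply/negP => /andP [/imsetP [z + ->] /imsetP [z' + ez']].
  rewrite !in_nbrs => e1 e2; move: ez'; rewrite /phi1 /phi2.
  (* Two shifted values lie in different arcs. A shifted value equal to an unshifted one gives a
     crossing exchange, along the path or its reverse; a common neighbour z outside C gives a longer
     cycle through the path and z. *)
  case: ifP => zI; case: ifP => zI'.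
  - have [k [_ -> kI _]] := prv1 z zI e1; have [k' [_ -> /setDP [_ kI'] _]] := prv2 z' zI' e2.
    by move=> ek; rewrite -ek kI in kI'.
  - have [k [ezk -> kI ik]] := prv1 z zI e1 => ek.
    apply: (@exchange_crossing_at _ e e_sym N g cC i (i + m) k (h :: p)) => //.
    + by nat_lia.
    + by rewrite -ezk.
    by rewrite ek e_sym.
  - have [k [ezk -> kI ik]] := prv2 z' zI' e2 => ek.
    apply: (@exchange_crossing_at _ e e_sym N g cC (i + m) (i + N) k (rev (h :: p))) => //.
    + by nat_lia.
    + by rewrite g_per.
    + by rewrite size_rev.
    + by rewrite -ezk.
    by rewrite -ek e_sym -addSn g_per.
  move=> eqz; subst z'; have zC : z \notin C.
    by apply/negP => zC; rewrite in_setD zI zC in zI'.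
  have zH : z \notin H by apply: contraL e1 => /y1H.
  suff : size (h :: p) + size [:: z] + 2 <= (i.+1 - i) + ((i + m).+1 - (i + m)).
    by rewrite /= !subSnn; nat_lia.
  apply: (exchange_chord_at e_sym cC) => //; try by nat_lia.
    have /andP [uq Cq] := oq; rewrite /off_cycle cat_uniq uq all_cat Cq /= zC orbF !andbT.
    by apply: contra zH; apply: pH.
  by rewrite /= e1 e_sym e2.
have sub : phi1 @: nbrs e y1 :|: phi2 @: nbrs e y2 \subset ~: H.
  rewrite subUset; apply/andP; split; apply/subsetP => w /imsetP [z + ->]; rewrite in_nbrs in_setC => ez.
    rewrite /phi1; case: ifP => _; last by apply: contraL ez => /y1H.
    by apply/negP => /HC; rewrite (prv_cyc cC).
  rewrite /phi2; case: ifP => _; last by apply: contraL ez => /y2H.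
  by apply/negP => /HC; rewrite (prv_cyc cC).
have := subset_leq_card sub; rewrite cardsU dis cards0 !card_in_imset //.
have := cardsC H; rewrite -/y1 -/y2; nat_lia.
Qed.

End OffCyclePaths.

(** * Off-cycle paths with at least d vertices *)

Section LongOffPath.
Variables (V : finType) (e : rel V).
Hypotheses (e_sym : symmetric e) (e_irr : irreflexive e).
Variables (N : nat) (g : nat -> V).
Hypothesis cC : longest_cycle e N g.
Local Notation C := (cyc N g).
Variables (x : V) (q : seq V).
Hypothesis offq : off_path e N g (x :: q).

(** Both arcs between the two attachments would have more than [(size s).+1] edges, too many for
    N. *)
Lemma attach_eq y s i m : off_path e N g (y :: s) -> N <= 2 * (size s).+1 ->
  0 < m < N -> g i \in attach e N g y -> g (i + m) \in attach e N g (last y s) -> False.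
Proof.
move=> offs leN mN yi lm; have lt1 := attach_gap e_sym cC offs mN yi lm.
have eN : g (i + m + (N - m)) = g i.
  by rewrite -addnA subnKC; [case: cC | nat_lia].
have := attach_gap_rev e_sym cC (a := N - m) offs _ lm; rewrite eN; move/(_ _ yi); nat_lia.
Qed.

Lemma attach_unique y s c c' : off_path e N g (y :: s) -> N <= 2 * (size s).+1 ->
  c \in attach e N g y -> c' \in attach e N g (last y s) -> c = c'.
Proof.
move=> offs leN cy c'l; apply/eqP; apply: contraT => neq.
have cC' : c \in C by case/setIP: cy.
have c'C : c' \in C by case/setIP: c'l.
have [i [m [ec ec' mN]]] := g_pair cC cC' c'C neq.
by case: (@attach_eq y s i.+1 m) => //; rewrite -?ec -?ec'.
Qed.

Hypothesis q_max : forall s, off_path e N g s -> size s <= size (x :: q).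

(** A neighbour of y off both the path and C would prolong a longest path. *)
Lemma longest_off_path_nbrs y s : off_path e N g (y :: s) -> size s = size q ->
  nbrs e y \subset [set z in s] :|: attach e N g y.
Proof.
move=> offs eqs; apply/subsetP => z yz; rewrite in_setU [z \in [set _ in _]]in_set in_setI yz /=.
rewrite in_nbrs in yz; case: (boolP (z \in s)) => //= zs; apply: contraT => zC.
have : off_path e N g (z :: y :: s).
  have /andP [/andP [us Cs] ps] := offs.
  rewrite /off_path /off_cycle /= in us Cs ps *.
  rewrite (e_sym z) yz us Cs ps in_cons (negbTE zs) orbF zC !andbT.
  by apply: contraTneq yz => ->; rewrite e_irr.
by move/q_max; rewrite /= eqs ltnn.
Qed.

Let r : rel V := [rel a b | [&& e a b, a \notin C & b \notin C]].
(** The component of x in G - C. *)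
Let H : {set V} := [set z | connect r x z].

Let r_sym : symmetric r.
Proof. by move=> a b; rewrite /r /= e_sym; case: (e b a) => //=; rewrite andbC. Qed.

Let xC : x \notin C. Proof. by apply: (off_pathP offq); rewrite inE eqxx. Qed.

Let HC z : z \in H -> z \notin C.
Proof.
rewrite in_set => /connectP [p]; case/lastP: p => [|p y]; first by move=> _ ->.
by rewrite rcons_path last_rcons => /andP [_ /and3P [_ _ yC]] ->.
Qed.

Let H_closed z w : z \in H -> e z w -> w \notin C -> w \in H.
Proof.
move=> zH zw wC; rewrite in_set; move: (zH); rewrite in_set => /connect_trans; apply.
by apply: connect1; rewrite /r /= zw wC HC.
Qed.

Let H_path h h' : h \in H -> h' \in H -> exists p, [/\ off_path e N g (h :: p), last h p = h'
  & forall z, z \in h :: p -> z \in H].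
Proof.
rewrite !in_set => xh xh'; have : connect r h h'.
  by apply: connect_trans xh'; rewrite (sym_connect_sym r_sym).
case/connectP => p0 pp ->; case/shortenP: pp => p pp up _ {p0}.
have pH z : z \in h :: p -> z \in H.
  by move=> zp; rewrite in_set; apply: connect_trans xh _; apply: (path_connect pp).
exists p; split=> //; apply/andP; split; last by apply: sub_path pp => a b /andP [].
by rewrite /off_cycle up; apply/allP => z /pH /HC.
Qed.

Let qH z : z \in x :: q -> z \in H.
Proof.
have /andP [/andP [_ Cq] pq] := offq; move=> zq; rewrite in_set.
apply: (@path_connect _ r x q) => //; move: Cq pq {zq}; rewrite /r /=.
elim: (q) (x) => //= b s IHs a /and3P [aC bC sC] /andP [-> ps].
by rewrite aC bC IHs //= bC.
Qed.

(** Otherwise a path of H from h to z could be inserted between [g i] and [g i.+1]. *)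
Let next_off_H h i : h \in H -> e h (g i) -> forall z, z \in H -> ~~ e (g i.+1) z.
Proof.
move=> hH hi z zH; apply/negP => iz; have [p [offp lz _]] := H_path hH zH.
have := @attach_gap _ _ e_sym _ _ cC h p i 1 offp.
rewrite !in_setI !in_nbrs !(mem_cyc cC) lz hi addn1 e_sym iz.
have : 2 < N by case: cC.
move=> N2 /(_ _ isT isT); nat_lia.
Qed.

Variable d : nat.
Hypotheses (e_conn : connected e) (d_gt1 : 1 < d) (deg_ge : forall y, d <= #|nbrs e y|).
Hypothesis leafb : forall S, conn_set e S -> #|bnd e S| < 2 * d.
Hypotheses (order : #|V| <= 3 * d) (q_long : d <= size (x :: q)).

Let cardH : d <= #|H|.
Proof.
apply: leq_trans q_long _; have /card_uniqP <- := off_path_uniq offq.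
by apply/subset_leq_card/subsetP => z; apply: qH.
Qed.

(** As c1 is no cut vertex, some edge from H to C avoids c1; as h1 is none, another avoids h1. If
    neither is disjoint from h1 c1, the first contains h1 and the second c1, and they are disjoint
    from each other. *)
Let disjoint_edges : exists h1 c1 h2 c2, [/\ h1 \in H, h2 \in H, c1 \in C & c2 \in C] /\
  [/\ h1 != h2, c1 != c2, e h1 c1 & e h2 c2].
Proof.
have N2 : 2 < N by case: cC.
have xH : x \in H by rewrite in_set.
have g0H : g 0 \notin H by apply/negP => /HC; rewrite (mem_cyc cC).
have exitC h c : h \in H -> c \notin H -> e h c -> c \in C.
  by move=> hH + hc; apply: contraNT => ?; apply: H_closed hH hc _.
have [h1 [c1 [h1H c1H h1c1]]] := edge_exit e_conn xH g0H.
have c1C := exitC _ _ h1H c1H h1c1.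
have cut1 : [exists h in H, exists c in C :\ c1, e h c].
  apply: contraT => no; case: (@no_cut_vertex V e d e_sym e_irr e_conn d_gt1 deg_ge c1 H (~: H :\ c1)) => //.
  - by apply/set0Pn; exists x.
  - have [c cC1] : exists c, c \in C :\ c1.
      by apply/set0Pn; rewrite -card_gt0; have := cardsD1 c1 C; rewrite c1C (card_cyc cC); nat_lia.
    case/setD1P: cC1 => cc1 cCC; apply/set0Pn; exists c; rewrite in_setD1 cc1 in_setC.
    by apply: contraL cCC => /HC.
  - by apply/pred0P => z /=; rewrite in_setD1 in_setC; case: (z \in H); rewrite ?andbF.
  - by rewrite in_setD1 eqxx.
  - apply/setP => z; rewrite in_setU in_setD1 in_setC in_setC1.
    by case: eqP => [->|_] /=; [rewrite (negbTE c1H) | case: (z \in H)].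
  move=> a b aH; rewrite in_setD1 in_setC => /andP [bc bH].
  apply: contra no => ab; apply/exists_inP; exists a => //; apply/exists_inP; exists b => //.
  by rewrite in_setD1 bc (exitC a).
have cut2 : [exists h in H :\ h1, exists c in C, e h c].
  apply: contraT => no; case: (@no_cut_vertex V e d e_sym e_irr e_conn d_gt1 deg_ge h1 (H :\ h1) (~: H)) => //.
  - by rewrite -card_gt0; have := cardsD1 h1 H; rewrite h1H; nat_lia.
  - by apply/set0Pn; exists c1; rewrite in_setC.
  - by apply/pred0P => z /=; rewrite in_setD1 in_setC; case: (z \in H); rewrite ?andbF.
  - by rewrite in_setD1 eqxx.
  - by rewrite in_setC negbK.
  - apply/setP => z; rewrite in_setU in_setD1 in_setC in_setC1.
    by case: eqP => [->|_] /=; [rewrite h1H | case: (z \in H)].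
  move=> a b aH; rewrite in_setC => bH; have /setD1P [_ aH'] := aH.
  apply: contra no => ab; apply/exists_inP; exists a => //; apply/exists_inP; exists b => //.
  exact: exitC ab.
case/exists_inP: cut1 => h hH /exists_inP [c /setD1P [cc1 cCC] hc].
have [eqh|hh1] := eqVneq h h1; last by exists h1, c1, h, c; split; split=> //; rewrite eq_sym.
case/exists_inP: cut2 => h' /setD1P [h'h1 h'H] /exists_inP [c' c'C h'c'].
have [eqc|c'c1] := eqVneq c' c1; last by exists h1, c1, h', c'; split; split=> //; rewrite eq_sym.
by subst h c'; exists h1, c, h', c1; split; split; rewrite // eq_sym.
Qed.

Lemma long_off_path_contra : False.
Proof.
have N2 : 2 < N by case: cC.
have [h1 [c1 [h2 [c2 [[h1H h2H c1C c2C] [hh cc hc1 hc2]]]]]] := disjoint_edges.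
have [p [offp lp pH]] := H_path h1H h2H.
have [i0 [m [ec1 ec2 mN]]] := g_pair cC c1C c2C cc.
have p1 : 0 < size p.
  by rewrite lt0n size_eq0; apply: contraNneq hh => ep; rewrite -lp ep.
have a1 : g i0.+1 \in attach e N g h1 by rewrite -ec1 in_setI in_nbrs hc1.
have a2 : g (i0.+1 + m) \in attach e N g (last h1 p) by rewrite -ec2 lp in_setI in_nbrs hc2.
(* The two gap estimates supply the conditions on m in [crossing_count]. *)
have gap1 := attach_gap e_sym cC offp mN a1 a2.
have gap2 : (size p).+1 < N - m.
  apply: (attach_gap_rev e_sym cC offp _ a2); first by nat_lia.
  by rewrite -addnA subnKC; [case: cC => _ _ -> | nat_lia].
have le : 2 * d + #|H| <= #|V|.
  have := @crossing_count _ _ e_sym e_irr _ _ cC i0.+1 m h1 p H offp.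
  rewrite -ec1 e_sym hc1 lp -ec2 hc2 => bound.
  apply: leq_trans (bound _ _ isT isT pH HC _ _); try by nat_lia.
  - by rewrite mul2n -addnn leq_add2r leq_add.
  - by apply: (next_off_H h1H); rewrite -ec1.
  - by apply: (next_off_H h2H); rewrite -ec2.
have cHC : #|H| + N <= #|V|.
  rewrite -(card_cyc cC) -(cardsC H) leq_add2l; apply/subset_leq_card/subsetP => z zC.
  by rewrite in_setC; apply: contraL zC => /HC.
have cq : #|[set z in x :: q]| = size (x :: q).
  by rewrite cardsE; apply/card_uniqP/off_path_uniq/offq.
(* The bound [le] leaves at most d vertices for H, and the path already has d of them. *)
have eqH : [set z in x :: q] = H.
  apply/eqP; rewrite eqEcard cq; apply/andP; split; last by nat_lia.
  by apply/subsetP => z; rewrite in_set; apply: qH.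
have inH z : (z \in H) = (z \in x :: q) by rewrite -eqH in_set.
have dH : #|H| = d by nat_lia.
have sq : (size q).+1 = d by rewrite -dH -eqH cq.
have splitH h : h \in H -> nbrs e h \subset (H :\ h) :|: attach e N g h.
  move=> hH; apply/subsetP => z hz; rewrite in_setU in_setD1 in_setI hz /=; rewrite in_nbrs in hz.
  case: (boolP (z \in C)) => zC; rewrite ?orbT // (H_closed hH hz zC) orbF andbT.
  by apply: contraTneq hz => ->; rewrite e_irr.
have att h : h \in H -> exists c, c \in attach e N g h.
  move=> hH; apply/set0Pn; rewrite -card_gt0.
  have := subset_leq_card (splitH h hH); have := deg_ge h; have := cardsD1 h H; rewrite hH.
  by rewrite cardsU; nat_lia.
have xH : x \in H by rewrite in_set.
have lH : last x q \in H by rewrite inH mem_last.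
(* Since H takes d of at most 3 * d vertices, N is at most 2 * d and [attach_unique] applies to
   Hamiltonian paths of H. *)
have leN : N <= 2 * (size q).+1 by nat_lia.
have [c cx] := att x xH; have [c' c'l] := att _ lH.
have ec' := attach_unique offq leN cx c'l; subst c'.
have att_x : attach e N g x = [set c].
  apply/setP => z; rewrite in_set1; apply/idP/eqP => [zx|-> //].
  exact: attach_unique offq leN zx c'l.
(* Having a single neighbour on C, x needs all other d - 1 vertices of H. *)
have xq z : z \in q -> e x z.
  move=> zq; rewrite -in_nbrs.
  have sub : H :\ x \subset nbrs e x.
    have := subset_leq_card (splitH x xH); rewrite att_x => le1.
    have leI : #|H :\ x| <= #|nbrs e x :&: (H :\ x)|.
      have : nbrs e x \subset (nbrs e x :&: (H :\ x)) :|: [set c].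
        apply/subsetP => y yx; have := subsetP (splitH x xH) y yx.
        by rewrite att_x !in_setU [y \in _ :&: _]in_setI yx.
      move/subset_leq_card; rewrite cardsU cards1; have := deg_ge x.
      have := cardsD1 x H; rewrite xH; nat_lia.
    have : nbrs e x :&: (H :\ x) == H :\ x by rewrite eqEcard subsetIr leI.
    by move/eqP <-; rewrite subsetIl.
  apply: (subsetP sub); rewrite in_setD1 inH inE zq orbT andbT.
  have := off_path_uniq offq; rewrite cons_uniq => /andP [xnq _].
  by apply: contraTneq zq => ->.
have att_l : attach e N g (last x q) = [set c].
  apply/setP => z; rewrite in_set1; apply/idP/eqP => [zl|-> //].
  exact/esym/(attach_unique offq leN cx zl).
(* By rotation h starts a Hamiltonian path of H ending in x or in [last x q], both attached to c
   only. *)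
have att_h h c'' : h \in H -> c'' \in attach e N g h -> c'' = c.
  rewrite inH => hq ch; have [s [offs _ ss ls]] := rotate_path e_sym offq xq hq.
  apply: (attach_unique offs _ ch); first by rewrite ss.
  by case: ls => ->; rewrite ?att_l ?att_x set11.
have e1 : c1 = c by apply: (att_h h1) => //; rewrite ec1.
have e2 : c2 = c by apply: (att_h h2) => //; rewrite in_setI in_nbrs hc2.
by rewrite e1 e2 eqxx in cc.
Qed.

End LongOffPath.

(** * Paths with fewer than d vertices outside a longest cycle *)

Section Shifts.
Variables (V : finType) (e : rel V) (N : nat) (g : nat -> V).
Hypothesis cC : longest_cycle e N g.
Local Notation C := (cyc N g).

Definition shift r z := iter r (nxt N g) z.

Lemma shift_g r i : shift r (g i) = g (i + r).
Proof. by elim: r => [|r IHr]; rewrite ?addn0 //= IHr (nxt_g cC) addnS. Qed.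

Lemma shift_cyc r z : z \in C -> shift r z \in C.
Proof. by case: r => //= r _; apply: (nxt_cyc cC). Qed.

Lemma shift_inj r z w : z \in C -> w \in C -> shift r z = shift r w -> z = w.
Proof.
move=> zC wC; elim: r => //= r IHr /(nxt_inj cC) eq; apply: IHr; apply: eq; exact: shift_cyc.
Qed.

Lemma shift_reach z w : z \in C -> w \in C -> exists2 r, r < N & w = shift r z.
Proof.
move=> /(g_of cC) [i ->] wC; have [k ik ->] := cycP cC wC i.+1.
by exists (k - i.+1); [nat_lia | rewrite shift_g subnKC //; nat_lia].
Qed.

(** Each z in A claims the positions 0 and 1 counted from it; B is meant for those z followed by l
    vertices outside A, which also claim the positions 2 to l. These claims are disjoint, and
    counting them bounds the two sets in terms of N. *)
Definition shifts (A B : {set V}) (l : nat) : {set V} :=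
  [set shift p.2 p.1 | p : V * 'I_l.+1 in setX A [set r : 'I_l.+1 | r <= 1] :|: setX B [set r : 'I_l.+1 | 1 < r]].

Section SpacedSets.
Variables (A B : {set V}) (l : nat).
Hypotheses (AC : A \subset C) (BA : B \subset A) (l_gt0 : 0 < l).
Hypothesis next_notin : forall z, z \in A -> nxt N g z \notin A.
Hypothesis shift_notin : forall z r, z \in B -> 0 < r <= l -> shift r z \notin A.

(** Cancelling the smaller shift puts w itself, a vertex of A, among the positions claimed after z,
    where A is excluded. *)
Lemma shift_spaced_inj z w r t : z \in A -> w \in A -> (r <= 1) || (z \in B) && (r <= l) ->
  (t <= 1) || (w \in B) && (t <= l) -> shift r z = shift t w -> z = w /\ r = t.
Proof.
wlog le : z w r t / t <= r => [hw|] zA wA hr ht eq.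
  have [|/ltnW] := leqP t r => le; first exact: hw.
  by have [] := hw w z t r le wA zA ht hr (esym eq).
have wC := subsetP AC w wA; have zC := subsetP AC z zA.
have eq' : shift (r - t) z = w.
  apply: (@shift_inj t) => //; first exact: shift_cyc.
  by rewrite -eq /shift -iterD subnKC.
have [rt|rt] := posnP (r - t).
  by split; [rewrite -eq' rt | nat_lia].
have : w \notin A; last by rewrite wA.
rewrite -eq'; case/orP: hr => [r1|/andP [zB rl]]; last by apply: shift_notin => //; nat_lia.
have -> : r - t = 1 by nat_lia.
exact: next_notin.
Qed.

Lemma card_shifts : #|shifts A B l| = 2 * #|A| + l.-1 * #|B|.
Proof.
rewrite card_in_imset.
  rewrite cardsU (_ : setX _ _ :&: setX _ _ = set0) ?cards0 ?subn0; last first.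
    apply/setP => -[z r]; rewrite in_set0 in_setI !in_setX !in_set; apply/negP.
    by case/andP=> /andP [_ r1] /andP [_]; rewrite ltnNge r1.
  have c1 : #|[set r : 'I_l.+1 | r <= 1]| = 2.
    have -> : [set r : 'I_l.+1 | r <= 1] = [set inord 0; inord 1].
      apply/setP => r; rewrite !inE -!val_eqE /= !inordK //; by case: (r : nat) => [|[]].
    by rewrite cards2 -val_eqE /= !inordK.
  have c2 : #|[set r : 'I_l.+1 | 1 < r]| = l.-1.
    have -> : [set r : 'I_l.+1 | 1 < r] = ~: [set r : 'I_l.+1 | r <= 1].
      by apply/setP => r; rewrite !inE ltnNge.
    have := cardsC [set r : 'I_l.+1 | r <= 1]; rewrite c1 card_ord; nat_lia.
  by rewrite !cardsX c1 c2 mulnC (mulnC _ l.-1).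
move=> [z r] [w t]; rewrite !in_setU !in_setX !in_set /= => hz hw eq.
have zA : z \in A by case/orP: hz => /andP [// /(subsetP BA)].
have wA : w \in A by case/orP: hw => /andP [// /(subsetP BA)].
have [||-> /val_inj -> //] := @shift_spaced_inj z w r t zA wA _ _ eq.
  by case/orP: hz => /andP [zX rX]; rewrite ?rX // zX leq_ord orbT.
by case/orP: hw => /andP [zX rX]; rewrite ?rX // zX leq_ord orbT.
Qed.

Lemma shifts_sub : shifts A B l \subset C.
Proof.
apply/subsetP => _ /imsetP [[z r] zr ->]; rewrite in_setU !in_setX in zr; apply: shift_cyc.
by apply: (subsetP AC); case/orP: zr => /andP [// /(subsetP BA)].
Qed.

Lemma spaced_bound : 2 * #|A| + l.-1 * #|B| <= N.
Proof. by rewrite -card_shifts -(card_cyc cC); apply/subset_leq_card/shifts_sub. Qed.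

End SpacedSets.

(** Take y in A1 but not in A2 with the shortest way forward to A2. A vertex of A1 outside A2 met on
    that way would have a shorter one, and A2 is more than l steps ahead. *)
Lemma last_before_switch (A1 A2 : {set V}) l z w : l < N -> A1 \subset C -> A2 \subset C ->
  (forall y r, y \in A1 -> 0 < r < N -> shift r y \in A2 -> l < r) ->
  z \in A1 :\: A2 -> w \in A2 ->
  exists2 y, y \in A1 :\: A2 & forall r, 0 < r <= l -> shift r y \notin A1 :|: A2.
Proof.
move=> lN A1C A2C gap zA wA.
pose P r := [exists y in A1 :\: A2, shift r y \in A2].
have zC : z \in C by apply: (subsetP A1C); case/setDP: zA.
have [r0 r0N ew] := shift_reach zC (subsetP A2C w wA).
have exP : exists r, P r by exists r0; apply/exists_inP; exists z => //; rewrite -ew.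
case: (ex_minnP exP) => m /exists_inP [y yA ym] m_min.
have mN : m < N.
  by apply: leq_ltn_trans r0N; apply: m_min; apply/exists_inP; exists z => //; rewrite -ew.
have m0 : 0 < m.
  by rewrite lt0n; apply/negP => /eqP m0; rewrite m0 in ym; case/setDP: yA => _ /negP; apply.
have [yA1 _] := setDP yA.
exists y => // r rl; rewrite in_setU; apply/negP => rA.
have [rA2|rA2] := boolP (shift r y \in A2).
  have := gap y r yA1 _ rA2; nat_lia.
have rA1 : shift r y \in A1 :\: A2.
  by rewrite in_setD rA2; case/orP: rA => // rA; rewrite rA in rA2.
have [le|lt] := leqP r m.
  have : m <= m - r.
    by apply: m_min; apply/exists_inP; exists (shift r y); rewrite // /shift -iterD subnK.
  nat_lia.
have := gap y m yA1 _ ym; nat_lia.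
Qed.

End Shifts.

(** Here a1 and a2 count the attachments of the two ends of the path, b the common ones and G those
    followed by a long gap. Each way in which the two sets differ costs one more long gap, and these
    do not fit in N <= 2 * l + 3 * k. *)
Lemma ends_arith l k a1 a2 b G N : 1 < l -> 0 < k -> k < a1 -> k < a2 -> b <= a1 -> b <= a2 ->
  b + (b < a1) + (b < a2) <= G -> 2 * (a1 + a2 - b) + l.-1 * G <= N -> N + l <= 3 * (l + k) ->
  [/\ b = a1, b = a2 & a1 = k.+1].
Proof.
case: l => [|[|j]] // _ k0 ka1 ka2 ba1 ba2; rewrite /=.
case: (ltnP b a1) => b1; case: (ltnP b a2) => b2; rewrite ?addn0 ?addn1 => hG hN h3.
- have : j.+1 * b.+2 <= j.+1 * G by rewrite leq_mul2l.
  move: (j.+1 * G) hN => x hN; nia.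
- have : j.+1 * b.+1 <= j.+1 * G by rewrite leq_mul2l.
  move: (j.+1 * G) hN => x hN; nia.
- have : j.+1 * b.+1 <= j.+1 * G by rewrite leq_mul2l.
  move: (j.+1 * G) hN => x hN; nia.
- have : j.+1 * b <= j.+1 * G by rewrite leq_mul2l hG orbT.
  have eb1 : b = a1 by lia.
  have eb2 : b = a2 by lia.
  subst a1 a2; move: (j.+1 * G) hN => x hN hx; split=> //.
  nia.
Qed.

Section ShortOffPath.
Variables (V : finType) (e : rel V).
Hypotheses (e_sym : symmetric e) (e_irr : irreflexive e).
Variables (N : nat) (g : nat -> V).
Hypothesis cC : longest_cycle e N g.
Local Notation C := (cyc N g).
Local Notation att := (attach e N g).
Local Notation sh := (shift N g).
Variables (x : V) (q : seq V).
Hypothesis offq : off_path e N g (x :: q).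
Hypothesis q_max : forall s, off_path e N g s -> size s <= size (x :: q).
Local Notation l := (size q).+1.
Variable k : nat.
Hypotheses (l_gt1 : 1 < l) (k_gt0 : 0 < k) (lN : l < N).
Hypothesis deg_ge : forall y, l + k <= #|nbrs e y|.
Hypothesis order : #|V| <= 3 * (l + k).

Let att_cyc y : att y \subset C. Proof. exact: subsetIr. Qed.

Let shift_gap y s z r : off_path e N g (y :: s) -> z \in att y -> 0 < r < N ->
  sh r z \in att (last y s) -> (size s).+1 < r.
Proof.
move=> offs zy rN; have zC := subsetP (att_cyc y) z zy.
have [i ez] := g_of cC zC; move: zy; rewrite ez (shift_g cC) => zy zr.
exact: (attach_gap e_sym cC offs rN zy zr).
Qed.

Let shift_gap_rev y s z r : off_path e N g (y :: s) -> z \in att (last y s) -> 0 < r < N ->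
  sh r z \in att y -> (size s).+1 < r.
Proof.
move=> offs zy rN; have zC := subsetP (att_cyc _) z zy.
have [i ez] := g_of cC zC; move: zy; rewrite ez (shift_g cC) => zy zr.
exact: (attach_gap_rev e_sym cC offs rN zy zr).
Qed.

Let card_off y s : off_path e N g (y :: s) -> N + (size s).+1 <= #|V|.
Proof.
move=> offs; have cs : #|y :: s| = (size s).+1 by apply/card_uniqP/off_path_uniq/offs.
rewrite -cs.
rewrite -(card_cyc cC) -(cardsC C) leq_add2l.
by apply/subset_leq_card/subsetP => z zs; rewrite in_setC (off_pathP offs).
Qed.

(** An end of a longest path has at most l - 1 neighbours on the path, hence at least k + 1 on C,
    with equality only if it sees the whole path. Counting gaps forces this equality. *)
Lemma equal_ends y s : off_path e N g (y :: s) -> size s = size q ->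
  [/\ att y = att (last y s), #|att y| = k.+1 & [set z in s] \subset nbrs e y].
Proof.
move=> offs eqs; set A1 := att y; set A2 := att (last y s).
have deg_att t w : off_path e N g (w :: t) -> size t = size q ->
    k < #|att w| /\ (#|att w| <= k.+1 -> [set z in t] \subset nbrs e w).
  move=> offt eqt; have sub := longest_off_path_nbrs e_sym e_irr q_max offt eqt.
  have ct : #|[set z in t]| = size q.
    rewrite cardsE -eqt; apply/card_uniqP.
    by have := off_path_uniq offt => /andP [].
  have := subset_leq_card sub; have := deg_ge w; rewrite cardsU ct => dw le.
  split=> [|le']; first by nat_lia.
  have : #|[set z in t]| <= #|nbrs e w :&: [set z in t]|.
    have sub' : nbrs e w \subset (nbrs e w :&: [set z in t]) :|: att w.
      apply/subsetP => z zw; have := subsetP sub z zw.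
      by rewrite !in_setU [z \in nbrs e w :&: [set _ in t]]in_setI zw.
    have := subset_leq_card sub'; rewrite cardsU ct; nat_lia.
  move=> leI; have /eqP <- : nbrs e w :&: [set z in t] == [set z in t].
    by rewrite eqEcard subsetIr leI.
  exact: subsetIl.
have [k1 full] := deg_att s y offs eqs; rewrite -/A1 in k1 full.
have [k2 _] : k < #|A2| /\ True.
  split=> //; have := off_path_rev e_sym offs; rewrite lastI rev_rcons => offr.
  by case: (deg_att _ _ offr); rewrite // size_rev size_belast.
have [n1 n2] : (exists z, z \in A1) /\ (exists z, z \in A2).
  by split; apply/set0Pn; rewrite -card_gt0; nat_lia.
have yC : y \notin C by apply: (off_pathP offs); rewrite inE eqxx.
have lC : last y s \notin C by apply: (off_pathP offs); rewrite mem_last.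
have gap12 z r : z \in A1 -> 0 < r < N -> sh r z \in A2 -> l < r.
  by move=> *; rewrite -eqs; apply: (@shift_gap y s z).
have gap21 z r : z \in A2 -> 0 < r < N -> sh r z \in A1 -> l < r.
  by move=> *; rewrite -eqs; apply: (@shift_gap_rev y s z).
pose A := A1 :|: A2.
(* G collects the attachments followed by at least l vertices that are not attachments. *)
pose G := [set z in A | [forall r : 'I_l.+1, (0 < r) ==> (sh r z \notin A)]].
have inG z : z \in A -> (forall r, 0 < r <= l -> sh r z \notin A) -> z \in G.
  move=> zA far; rewrite in_set zA; apply/forallP => r; apply/implyP => r0.
  by apply: far; rewrite r0 leq_ord.
have AC : A \subset C by rewrite subUset !att_cyc.
have N2 : 2 < N by case: cC.
have next z : z \in A -> nxt N g z \notin A.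
  have nc w z' : w \notin C -> z' \in att w -> nxt N g z' \notin att w.
    move=> wC; rewrite in_setI in_nbrs => /andP [wz zC].
    by rewrite in_setI in_nbrs (negbTE (no_consecutive e_sym cC wC zC wz)).
  rewrite !in_setU negb_or => /orP [zA|zA].
    rewrite (nc _ _ yC zA) /=; apply/negP => /(gap12 z 1 zA); nat_lia.
  rewrite (nc _ _ lC zA) andbT; apply/negP => /(gap21 z 1 zA); nat_lia.
have far z r : z \in G -> 0 < r <= l -> sh r z \notin A.
  rewrite in_set => /andP [_ /forallP all] /andP [r0 rl].
  by have := all (inord r); rewrite inordK // r0.
(* A common attachment belongs to both ends, so a gap estimate applies whichever end the next
   attachment belongs to. *)
have I_G : A1 :&: A2 \subset G.
  apply/subsetP => z /setIP [z1 z2]; apply: inG => [|r rl]; first by rewrite in_setU z1.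
  by rewrite in_setU; apply/norP; split; apply/negP => zr;
    [have := gap21 z r z2 _ zr | have := gap12 z r z1 _ zr]; nat_lia.
have G_bound : #|A1 :&: A2| + (#|A1 :&: A2| < #|A1|) + (#|A1 :&: A2| < #|A2|) <= #|G|.
  (* Along the cycle a vertex of B1 only is eventually followed by one of B2, and the last one
     before the switch lies in G. *)
  have one (B1 B2 : {set V}) : B1 :|: B2 = A -> (exists z, z \in B2) ->
      (forall z r, z \in B1 -> 0 < r < N -> sh r z \in B2 -> l < r) ->
      ((#|B1 :&: B2| < #|B1|)%N <= #|G :&: (B1 :\: B2)|).
    move=> eA [w wB] gapB; case: ltnP => //= lt.
    have [z zB] : exists z, z \in B1 :\: B2.
      by apply/set0Pn; rewrite -card_gt0; have := cardsID B2 B1; nat_lia.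
    have [||z' z'B far'] := last_before_switch cC lN _ _ gapB zB wB.
    - by apply: subset_trans AC; rewrite -eA subsetUl.
    - by apply: subset_trans AC; rewrite -eA subsetUr.
    rewrite card_gt0; apply/set0Pn; exists z'; rewrite in_setI z'B andbT.
    apply: inG => [|r rl]; last by rewrite -eA far'.
    by rewrite -eA in_setU; case/setDP: z'B => ->.
  have := one A1 A2 erefl n2 gap12; have := one A2 A1 (setUC _ _) n1 gap21.
  rewrite (setIC A2) => o2 o1.
  have := subset_leq_card I_G.
  have : #|A1 :&: A2| + #|G :&: (A1 :\: A2)| + #|G :&: (A2 :\: A1)| <= #|G|.
    have := cardsID A1 G; have := cardsID A2 (G :&: A1).
    rewrite (_ : G :\: A1 = G :&: (A2 :\: A1)); last first.
      apply/setP => z; rewrite in_setD [z \in G :&: _]in_setI in_setD; case zG: (z \in G); rewrite ?andbF //= andbT.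
      have : z \in A by move: zG; rewrite in_set => /andP [].
      by rewrite in_setU; case: (z \in A1); case: (z \in A2).
    rewrite -setIA (setIidPr I_G) (setIDA G A1); nat_lia.
  nat_lia.
have bound := spaced_bound cC AC _ _ next far.
have {}bound : 2 * #|A| + l.-1 * #|G| <= N.
  by apply: bound => //; apply/subsetP => z; rewrite in_set => /andP [].
have cA : #|A| = #|A1| + #|A2| - #|A1 :&: A2| by rewrite cardsU.
have I1 := subset_leq_card (subsetIl A1 A2); have I2 := subset_leq_card (subsetIr A1 A2).
rewrite cA in bound; have := card_off offs; rewrite eqs => leV.
have [|e1 e2 e3] := ends_arith l_gt1 k_gt0 k1 k2 I1 I2 G_bound bound; first by apply: leq_trans leV order.
split=> //; last by apply: full; rewrite -/A1 e3.
have i1 : A1 :&: A2 = A1 by apply/eqP; rewrite eqEcard subsetIl; nat_lia.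
have i2 : A1 :&: A2 = A2 by apply/eqP; rewrite eqEcard subsetIr; nat_lia.
exact: etrans (esym i1) i2.
Qed.

Let A := att x.
Let Q : {set V} := [set z in x :: q].

Let AC : A \subset C. Proof. exact: att_cyc. Qed.
Let cardA : #|A| = k.+1. Proof. by case: (equal_ends offq erefl). Qed.
Let att_last : att (last x q) = A. Proof. by case: (equal_ends offq erefl). Qed.
Let g_per i : g (i + N) = g i. Proof. by case: cC. Qed.

Let xq z : z \in q -> e x z.
Proof.
case: (equal_ends offq erefl) => _ _ /subsetP sub zq.
by have := sub z; rewrite in_set in_nbrs; apply.
Qed.

Let cardQ : #|Q| = l.
Proof. by rewrite cardsE; apply/card_uniqP/off_path_uniq/offq. Qed.

Let QC z : z \in Q -> z \notin C.
Proof. by rewrite in_set; apply: (off_pathP offq). Qed.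

(** Rotation makes h an end of a longest path whose other end is an end of the original one, and
    [equal_ends] compares the two. *)
Let attQ h : h \in Q -> att h = A.
Proof.
rewrite in_set => hq; have [s [offs _ ss ls]] := rotate_path e_sym offq xq hq.
have [-> _ _] := equal_ends offs ss.
by case: ls => ->; rewrite ?att_last.
Qed.

Let nbrsQ h : h \in Q -> nbrs e h \subset Q :|: A.
Proof.
move=> hQ; move: (hQ); rewrite in_set => hq.
have [s [offs mem_s ss ls]] := rotate_path e_sym offq xq hq.
apply: subset_trans (longest_off_path_nbrs e_sym e_irr q_max offs ss) _.
rewrite attQ //; apply: setSU; apply/subsetP => z; rewrite !in_set => zs.
by rewrite -mem_s inE zs orbT.
Qed.

Let adjQA h a : h \in Q -> a \in A -> e h a.
Proof. by move=> hQ; rewrite -(attQ hQ) in_setI in_nbrs => /andP []. Qed.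

Let thread a b : a \in A -> b \in A -> path e a (rcons (x :: q) b).
Proof.
move=> aA bA; have xQ : x \in Q by rewrite in_set inE eqxx.
rewrite rcons_cons /= (e_sym a) (adjQA xQ aA) rcons_path.
by have /andP [_ /= ->] := offq; rewrite adjQA // in_set mem_last.
Qed.

Let far a r : a \in A -> 0 < r <= l -> sh r a \notin A.
Proof.
move=> aA rl; apply/negP => arA; have := @shift_gap x q a r offq aA.
by rewrite att_last => /(_ _ arA); nat_lia.
Qed.

Let next a : a \in A -> nxt N g a \notin A.
Proof. by move=> aA; have := @far a 1 aA isT. Qed.

Let W := shifts N g A A l.
Let cardW : #|W| = l.+1 * k.+1.
Proof.
have l0 : 0 < l by [].
rewrite (card_shifts cC AC (subxx A) l0 next far) cardA.
by rewrite -mulnDl add2n prednK.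
Qed.

Let in_W a r : a \in A -> r <= l -> sh r a \in W.
Proof.
move=> aA rl; apply/imsetP; exists (a, inord r); last by rewrite /= inordK.
by rewrite in_setU !in_setX /= aA !in_set /= inordK //; case: (leqP r 1).
Qed.

Let W_inj a b r t : a \in A -> b \in A -> r <= l -> t <= l -> sh r a = sh t b -> a = b /\ r = t.
Proof.
move=> aA bA rl tl; apply: (shift_spaced_inj cC AC (ltn0Sn _) next far) => //.
  by rewrite aA rl orbT.
by rewrite bA tl orbT.
Qed.

Let WP z : z \in W -> exists a r, [/\ a \in A, r <= l & z = sh r a].
Proof.
case/imsetP => -[a r] + ->; rewrite in_setU !in_setX => ar; exists a, r; split=> //.
  by case/orP: ar => /andP [].
exact: leq_ord.
Qed.

Let WC : W \subset C. Proof. exact: (shifts_sub cC l AC (subxx A)). Qed.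

Let O := ~: (W :|: Q).

Let cardO : #|V| = l.+1 * k.+1 + l + #|O|.
Proof.
rewrite -(cardsC (W :|: Q)) cardsU cardW cardQ (_ : W :&: Q = set0) ?cards0 ?subn0 //.
apply/setP => z; rewrite in_set0 in_setI; apply/negP => /andP [/(subsetP WC) zC /QC].
by rewrite zC.
Qed.

(** W and Q take (l + 1) * (k + 1) + l vertices, and 3 * (l + k) exceeds this by 1 - (l - 2) * (k -
    1). So at most one exceptional vertex remains. *)
Let cardO1 : #|O| <= 1.
Proof. by have := order; rewrite cardO; move: #|O| l_gt1 k_gt0 => o; move: l k => *; nia. Qed.

Let O_eq z w : z \in O -> w \in O -> z = w.
Proof. by move=> zO wO; apply/eqP; apply: contraT => zw; have := cardO1;
  rewrite (cardsD1 z) (cardsD1 w) zO in_setD1 eq_sym zw wO. Qed.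

Let in_O a : a \in A -> sh l.+1 a \notin A -> sh l.+1 a \in O.
Proof.
move=> aA out; have aC := subsetP AC a aA.
rewrite in_setC in_setU negb_or; apply/andP; split; last first.
  by apply: contraL (shift_cyc cC l.+1 aC) => /QC.
apply/negP => /WP [b [[|r] [bA rl eq]]]; first by rewrite eq bA in out.
have bC := subsetP AC b bA.
have eq' : sh l a = sh r b.
  by move: eq => /= /(nxt_inj cC); apply; [apply: (shift_cyc cC l) | apply: (shift_cyc cC r)].
have [_ rE] := W_inj aA bA (leqnn l) (ltnW rl) eq'; nat_lia.
Qed.

(** The distance from a to the next attachment, which is [l.+2] if [sh l.+1 a] is the exceptional
    vertex. *)
Let gap a := if sh l.+1 a \in A then l.+1 else l.+2.

Let gap_bounds a : l < gap a <= l.+2.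
Proof. by rewrite /gap; case: ifP; nat_lia. Qed.

(** Two consecutive cycle vertices cannot both be the single vertex of O. *)
Let sh_gap a : a \in A -> sh (gap a) a \in A.
Proof.
move=> aA; rewrite /gap; case: ifP => // /negbT out; apply: contraT => out2.
have aC := subsetP AC a aA; have O1 := in_O aA out.
have O2 : sh l.+2 a \in O.
  rewrite in_setC in_setU negb_or; apply/andP; split; last first.
    by apply: contraL (shift_cyc cC l.+2 aC) => /QC.
  apply/negP => /WP [b [[|r] [bA rl eq]]]; first by rewrite eq bA in out2.
  have bC := subsetP AC b bA.
  move: O1; rewrite in_setC in_setU (_ : sh l.+1 a = sh r b) ?in_W //; first by nat_lia.
  by move: eq => /= /(nxt_inj cC); apply; [apply: (shift_cyc cC l.+1) | apply: (shift_cyc cC r)].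
have := nxt_edge cC (shift_cyc cC l.+1 aC).
by rewrite (_ : nxt N g _ = sh l.+1 a) ?e_irr //; apply: O_eq.
Qed.

Let gap_long a : a \in A -> gap a != l.+1 -> sh l.+1 a \in O /\ gap a = l.+2.
Proof. by move=> aA; rewrite /gap; case: ifP => [|/negbT out]; rewrite ?eqxx //; split=> //; apply: in_O. Qed.

Let far_gap a r : a \in A -> 0 < r < gap a -> sh r a \notin A.
Proof.
move=> aA; rewrite /gap; case: ifP => [_|/negbT out] rl; first by apply: far => //; nat_lia.
have [->//|ne] := eqVneq r l.+1; apply: far => //; nat_lia.
Qed.

Let gap_sum a b : a \in A -> b \in A -> a != b -> gap a + gap b <= (2 * l).+3.
Proof.
move=> aA bA ab; have ga := gap_bounds a; have gb := gap_bounds b.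
have [ea|/(gap_long aA) [oa ea]] := eqVneq (gap a) l.+1; first by nat_lia.
have [eb|/(gap_long bA) [ob eb]] := eqVneq (gap b) l.+1; first by nat_lia.
case/eqP: ab; have := O_eq oa ob; apply: (shift_inj cC); exact: (subsetP AC).
Qed.

(* Both crossing exchanges apply, and together they need more room than the two gaps have. *)
Let no_link a b r t w : a \in A -> b \in A -> a != b -> 0 < r < gap a -> 0 < t < gap b ->
  path e (sh r a) (rcons w (sh t b)) -> off_cycle N g ((x :: q) ++ w) -> False.
Proof.
move=> aA bA ab ra tb pw offw; have aC := subsetP AC a aA; have bC := subsetP AC b bA.
have [i [m [ea eb mN]]] := g_pair cC aC bC ab.
have eb' : b = sh m a by rewrite eb ea (shift_g cC).
have ma : gap a <= m.
  by rewrite leqNgt; apply/negP => lt; have := @far_gap a m aA; rewrite -eb' bA; nat_lia.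
have ea' : a = sh (N - m) b by rewrite ea eb (shift_g cC) -addnA subnKC ?g_per //; nat_lia.
have mb : gap b <= N - m.
  by rewrite leqNgt; apply/negP => lt; have := @far_gap b (N - m) bA; rewrite -ea' aA; nat_lia.
have ga := gap_bounds a; have gb := gap_bounds b.
have era : sh r a = g (i.+1 + r) by rewrite ea (shift_g cC).
have etb : sh t b = g (i.+1 + m + t) by rewrite eb (shift_g cC).
have ega : sh (gap a) a = g (i.+1 + gap a) by rewrite {2}ea (shift_g cC).
have egb : sh (gap b) b = g (i.+1 + m + gap b) by rewrite {2}eb (shift_g cC).
have b1 : size (x :: q) + size w + 2 <= (i.+1 + r - i.+1) + (i.+1 + m + t - (i.+1 + m)).
  apply: (exchange_chord_at e_sym cC _ _ offw); try by nat_lia.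
    by rewrite -ea -eb; apply: thread.
  by rewrite -era -etb.
(* The second exchange joins the attachments ending the two gaps; adding N places [sh r a] in the
   period that starts at [i.+1 + gap a]. *)
have b2 : size (x :: q) + size w + 2 <=
    (i.+1 + m + gap b - (i.+1 + m + t)) + (i.+1 + gap a + N - (i.+1 + r + N)).
  apply: (exchange_chord_rev_at e_sym cC _ _ offw); try by nat_lia.
    by rewrite -ega -egb; apply: thread; apply: sh_gap.
  by rewrite g_per -era -etb.
(* Added up, [b1] and [b2] have at least 2 * l + 4 on the left and exactly [gap a + gap b] on the
   right. *)
have := gap_sum aA bA ab; rewrite /= in b1 b2; nat_lia.
Qed.

(** The inner vertices of the gap after a. *)
Let J a : {set V} := [set z | [exists r : 'I_(gap a), (0 < r) && (z == sh r a)]].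

Let JP a z : reflect (exists2 r, 0 < r < gap a & z = sh r a) (z \in J a).
Proof.
rewrite in_set; apply: (iffP existsP) => [[r /andP [r0 /eqP ->]]|[r /andP [r0 rg] ->]].
  by exists r; rewrite ?r0 ?ltn_ord.
by exists (Ordinal rg); rewrite r0 eqxx.
Qed.

Let cardJ a : #|J a| <= (gap a).-1.
Proof.
have sub : J a \subset [set sh r.+1 a | r : 'I_(gap a).-1].
  apply/subsetP => z /JP [r rg ->]; have r1 : r.-1 < (gap a).-1 by nat_lia.
  by apply/imsetP; exists (Ordinal r1); rewrite // -[in LHS](@prednK r) //; nat_lia.
apply: leq_trans (subset_leq_card sub) _; apply: leq_trans (leq_imset_card _ _) _.
by rewrite card_ord.
Qed.

Let JA a z : a \in A -> z \in J a -> z \notin A.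
Proof. by move=> aA /JP [r rg ->]; apply: far_gap. Qed.

Let JC a z : a \in A -> z \in J a -> z \in C.
Proof. by move=> aA /JP [r rg ->]; apply: (shift_cyc cC); apply: (subsetP AC). Qed.

Let coverC z : z \in C -> z \notin A -> exists2 a, a \in A & z \in J a.
Proof.
move=> zC zA; pose P r := [exists a in A, sh r a == z].
have [a0 a0A] : exists a, a \in A by apply/set0Pn; rewrite -card_gt0 cardA.
have exP : exists r, P r.
  have [r _ ez] := shift_reach cC (subsetP AC a0 a0A) zC.
  by exists r; apply/exists_inP; exists a0; rewrite // -ez.
case: (ex_minnP exP) => r /exists_inP [a aA /eqP ra] r_min.
exists a => //; apply/JP; exists r => //.
have r0 : 0 < r by rewrite lt0n; apply: contraNneq zA => r0; rewrite -ra r0.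
rewrite r0 ltnNge; apply/negP => le.
have : r <= r - gap a.
  by apply: r_min; apply/exists_inP; exists (sh (gap a) a); rewrite ?sh_gap // /shift -iterD subnK //; apply/eqP.
have := gap_bounds a; nat_lia.
Qed.

(** Edges to other gaps are excluded by [no_link] with an empty connection, and edges to Q because Q
    has neighbours only in Q and A. *)
Let nbrsJ b z : b \in A -> z \in J b ->
  nbrs e z \subset A :|: (J b :\ z) :|: (O :\: C).
Proof.
move=> bA zJ; apply/subsetP => w; rewrite in_nbrs => zw.
rewrite !in_setU in_setD1 in_setD; case: (boolP (w \in A)) => //= wA.
have -> : w != z by apply: contraTneq zw => ->; rewrite e_irr.
have [wC|wC] := boolP (w \in C).
  rewrite orbF; have [a aA wJ] := coverC wC wA.
  have [<- //|ab] := eqVneq a b.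
  have [r rb er] := JP _ _ zJ; have [t ta et] := JP _ _ wJ.
  case: (@no_link a b t r [::]) => //; last by rewrite cats0; case/andP: offq.
  by rewrite /= -er -et e_sym zw.
rewrite /= in_setC in_setU negb_or; apply/orP; right; apply/andP; split.
  by apply: contra wC; apply: (subsetP WC).
apply/negP => wQ; have := subsetP (nbrsQ wQ) z; rewrite in_nbrs e_sym zw in_setU.
move/(_ isT); rewrite (negbTE (JA bA zJ)) orbF => /QC.
by rewrite (JC bA zJ).
Qed.

Hypothesis leafb : forall S, conn_set e S -> #|bnd e S| < 2 * (l + k).

Let deg_lt a : #|nbrs e a| < 2 * (l + k).
Proof.
apply: leq_ltn_trans (leafb (conn_set1 e a)); apply/subset_leq_card/subsetP => z.
rewrite in_nbrs => az; apply: (@in_bnd _ _ _ a); rewrite ?set11 // in_set1.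
by apply: contraTneq az => ->; rewrite e_irr.
Qed.

(** A vertex of U misses at most one vertex of A, so two vertices of A miss disjoint parts of U and
    see everything else outside A. Their degrees sum to more than [deg_lt] allows. *)
Let few_missing (U : {set V}) : U :&: A = set0 -> #|U| <= l.+1 ->
  (forall z, z \notin A -> z \notin U -> A \subset nbrs e z) ->
  (forall z, z \in U -> k <= #|nbrs e z :&: A|) -> U = set0 \/ O != set0 -> False.
Proof.
move=> UA cU all_out most_in UO.
have [a [b [aA bA ab]]] : exists a b, [/\ a \in A, b \in A & a != b].
  have [a aA] : exists a, a \in A by apply/set0Pn; rewrite -card_gt0 cardA.
  have [b] : exists b, b \in A :\ a.
    by apply/set0Pn; rewrite -card_gt0; have := cardsD1 a A; rewrite aA cardA; nat_lia.
  by rewrite in_setD1 => /andP [ba bA]; exists a, b; rewrite eq_sym.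
pose miss c := [set z in U | ~~ e c z].
have deg c : c \in A -> #|V| <= #|nbrs e c| + #|miss c| + k.+1.
  move=> cA; rewrite -cardA -cardsT.
  have sub : [set: V] \subset nbrs e c :|: miss c :|: A.
    apply/subsetP => z _; rewrite !in_setU in_nbrs in_set.
    have [//|zA] := boolP (z \in A); first by rewrite orbT.
    have [zU|zU] := boolP (z \in U); first by case: (e c z).
    by have := subsetP (all_out z zA zU) c cA; rewrite in_nbrs e_sym => ->.
  by apply: leq_trans (subset_leq_card sub) _; rewrite !cardsU; nat_lia.
have dis : miss a :&: miss b = set0.
  apply/setP => z; rewrite in_set0 in_setI !in_set; apply/negP.
  case/andP => /andP [zU az] /andP [_ bz].
  have sub : nbrs e z :&: A \subset A :\ a :\ b.
    apply/subsetP => c; rewrite in_setI in_nbrs !in_setD1 => /andP [zc ->].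
    by rewrite andbT; apply/andP; split; apply: contraTneq zc => ->; rewrite e_sym.
  have := subset_leq_card sub; have := most_in z zU.
  have := cardsD1 a A; have := cardsD1 b (A :\ a); rewrite in_setD1 eq_sym ab aA bA cardA.
  nat_lia.
have sumU : #|miss a| + #|miss b| <= #|U|.
  have sub : miss a :|: miss b \subset U.
    by rewrite subUset; apply/andP; split; apply/subsetP => z; rewrite in_set => /andP [].
  by have := subset_leq_card sub; rewrite cardsU dis cards0 subn0.
have := deg a aA; have := deg b bA; have := deg_lt a; have := deg_lt b; rewrite cardO.
(* This is (l - 2) * (k - 1) >= 0. *)
have lk : l + 2 * k <= l * k + 2.
  by move: l_gt1 k_gt0; move: l k => *; nia.
have -> : l.+1 * k.+1 = l * k + l + k + 1 by rewrite mulSn mulnS; nat_lia.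
case: UO => [U0|]; first rewrite U0 cards0 in sumU; last rewrite -card_gt0; move: (l * k) lk.
  nat_lia.
nat_lia.
Qed.

Let degJ b z : b \in A -> z \in J b ->
  l + k < #|nbrs e z :&: A| + (gap b).-1 + #|nbrs e z :&: (O :\: C)|.
Proof.
move=> bA zJ; have := cardJ b; rewrite (cardsD1 z) zJ => cJ.
have sub : nbrs e z \subset (nbrs e z :&: A) :|: (J b :\ z) :|: (nbrs e z :&: (O :\: C)).
  apply/subsetP => w zw; have := subsetP (nbrsJ bA zJ) w zw.
  by rewrite !in_setU [w \in _ :&: A]in_setI [w \in _ :&: (O :\: C)]in_setI zw.
have := subset_leq_card sub; have := deg_ge z; rewrite !cardsU; nat_lia.
Qed.

Let all_A z : k < #|nbrs e z :&: A| -> A \subset nbrs e z.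
Proof.
move=> lt; have : nbrs e z :&: A == A by rewrite eqEcard subsetIr cardA.
by move/eqP <-; apply: subsetIl.
Qed.

Let adjQ z : z \in Q -> A \subset nbrs e z.
Proof. by move=> zQ; apply/subsetP => a aA; rewrite in_nbrs adjQA. Qed.

Let out_cases z : z \notin A -> [\/ z \in Q, exists2 b, b \in A & z \in J b | z \in O :\: C].
Proof.
move=> zA; have [zC|zC] := boolP (z \in C).
  by have [b bA zJ] := coverC zC zA; apply: Or32; exists b.
have [zQ|zQ] := boolP (z \in Q); first exact: Or31.
apply: Or33; rewrite in_setD zC in_setC in_setU negb_or zQ andbT.
by apply: contra zC; apply: (subsetP WC).
Qed.

Let JA0 a : a \in A -> J a :&: A = set0.
Proof.
move=> aA; apply/setP => z; rewrite in_set0 in_setI; apply/negP => /andP [zJ].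
by apply/negP; apply: JA zJ.
Qed.

(** In [few_missing] U consists of the inner vertices of the one gap influenced by the exceptional
    vertex: the gap containing it or, if it lies outside C, the gap containing all its neighbours
    outside A. If all gaps are short and no exceptional vertex lies outside C, U is empty. *)
Lemma short_off_path_contra : False.
Proof.
have [Oc0|[v vO]] := set_0Vmem (O :\: C).
  have [/exists_inP [a0 a0A long]|] := boolP [exists a in A, gap a != l.+1].
    have [o0 g0] := gap_long a0A long.
    apply: (@few_missing (J a0)); first exact: JA0.
    - by have := cardJ a0; rewrite g0.
    - move=> z zA zJ0; case: (out_cases zA) => [/adjQ //|[b bA zJ]|]; last by rewrite Oc0 in_set0.
      apply: all_A; have := degJ bA zJ; rewrite Oc0 setI0 cards0.
      have [->|/(gap_long bA) [ob _]] := eqVneq (gap b) l.+1; first by rewrite /=; nat_lia.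
      have eb : b = a0 by apply: (shift_inj cC) (O_eq ob o0); apply: (subsetP AC).
      by rewrite -eb zJ in zJ0.
    - by move=> z zJ; have := degJ a0A zJ; rewrite Oc0 setI0 cards0 g0 /=; nat_lia.
    - by right; apply/set0Pn; exists (sh l.+1 a0).
  move/exists_inPn => short; apply: (@few_missing set0); rewrite ?set0I ?cards0 //.
  - move=> z zA _; case: (out_cases zA) => [/adjQ //|[b bA zJ]|]; last by rewrite Oc0 in_set0.
    apply: all_A; have := degJ bA zJ; rewrite Oc0 setI0 cards0.
    by have /negPn /eqP -> := short b bA; rewrite /=; nat_lia.
  - by move=> z; rewrite in_set0.
  - by left.
have [vO' vC] := setDP vO.
have Oc1 : O :\: C = [set v].
  apply/setP => z; rewrite in_set1; apply/idP/eqP => [/setDP [zO _]|-> //]; exact: O_eq.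
have vQ : v \notin Q by move: vO'; rewrite in_setC in_setU negb_or => /andP [].
have vA : v \notin A by apply: contra vC; apply: (subsetP AC).
have short b : b \in A -> gap b = l.+1.
  move=> bA; apply/eqP; apply: contraT => /(gap_long bA) [ob _].
  by move: vC; rewrite (O_eq vO' ob) (shift_cyc cC) // (subsetP AC).
have nbrs_v z : e v z -> z \notin A -> exists2 b, b \in A & z \in J b.
  move=> vz zA; case: (out_cases zA) => [zQ|//|].
    have := subsetP (nbrsQ zQ) v; rewrite in_nbrs e_sym vz in_setU (negbTE vQ) (negbTE vA).
    by move/(_ isT).
  by rewrite Oc1 in_set1 => /eqP zv; rewrite zv e_irr in vz.
have [z0 vz0 z0A] : exists2 z, e v z & z \notin A.
  have /subsetPn [z] : ~~ (nbrs e v \subset A).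
    apply/negP => /subset_leq_card; rewrite cardA; have := deg_ge v; nat_lia.
  by rewrite in_nbrs; exists z.
have [a0 a0A z0J] := nbrs_v z0 vz0 z0A.
(* Neighbours of v in two different gaps would link them through v. *)
have one_gap z b : b \in A -> z \in J b -> e v z -> b = a0.
  move=> bA zJ vz; apply/eqP; apply: contraT => ba.
  have [r rb er] := JP _ _ zJ; have [t ta et] := JP _ _ z0J.
  case: (@no_link b a0 r t [:: v]) => //; first by rewrite /= -er -et e_sym vz vz0.
  have /andP [/andP [uq Cq] _] := offq.
  rewrite /off_cycle cat_uniq all_cat uq Cq [all _ [:: v]]/= vC /= orbF !andbT.
  by move: vQ; rewrite in_set.
(* The gap has at most l inner vertices, and v cannot see both of the first two. *)
have J_lt : #|nbrs e v :&: J a0| < l.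
  have s1 : sh 1 a0 \in J a0 by apply/JP; exists 1; rewrite ?(short a0).
  have s2 : sh 2 a0 \in J a0 by apply/JP; exists 2; rewrite ?(short a0).
  have cJ := cardJ a0; rewrite (short a0) //= in cJ.
  have [y yJ vy] : exists2 y, y \in J a0 & ~~ e v y.
    have [v1|] := boolP (e v (sh 1 a0)); last by exists (sh 1 a0).
    by exists (sh 2 a0) => //; apply: (no_consecutive e_sym cC vC _ v1); apply: (shift_cyc cC 1);
      apply: (subsetP AC).
  have sub : nbrs e v :&: J a0 \subset J a0 :\ y.
    apply/subsetP => z; rewrite in_setI in_nbrs in_setD1 => /andP [vz ->].
    by rewrite andbT; apply: contraNneq vy => <-.
  by have := subset_leq_card sub; have := cardsD1 y (J a0); rewrite yJ; nat_lia.
have Av : A \subset nbrs e v.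
  apply: all_A; have sub : nbrs e v \subset (nbrs e v :&: A) :|: (nbrs e v :&: J a0).
    apply/subsetP => z vz; rewrite in_setU [z \in _ :&: A]in_setI [z \in _ :&: J a0]in_setI vz /=.
    have [//|zA] := boolP (z \in A); rewrite in_nbrs in vz.
    by have [b bA zJ] := nbrs_v z vz zA; rewrite -(one_gap z b bA zJ vz).
  by have := subset_leq_card sub; have := deg_ge v; rewrite cardsU; nat_lia.
apply: (@few_missing (J a0)); first exact: JA0.
- by have := cardJ a0; rewrite (short a0) //=; nat_lia.
- move=> z zA zJ0; case: (out_cases zA) => [/adjQ //|[b bA zJ]|]; last by rewrite Oc1 in_set1 => /eqP ->.
  apply: all_A; have := degJ bA zJ; rewrite Oc1 (short b) //=.
  have -> : nbrs e z :&: [set v] = set0.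
    apply/setP => w; rewrite in_set0 in_setI in_nbrs in_set1; apply/negP => /andP [zw /eqP wv].
    by move: zJ0; rewrite -(one_gap z b) ?zJ // e_sym -wv.
  by rewrite cards0; nat_lia.
- move=> z zJ; have := degJ a0A zJ; rewrite Oc1 (short a0) //=.
  by have := subset_leq_card (subsetIr (nbrs e z) [set v]); rewrite cards1; nat_lia.
- by right; apply/set0Pn; exists v.
Qed.

End ShortOffPath.

(** * Existence of long cycles *)

Lemma min_degree_le (V : finType) (e : rel V) x : min_degree e <= #|nbrs e x|.
Proof.
rewrite /min_degree; elim: (index_enum V) (mem_index_enum x) => // y s IHs.
rewrite inE big_cons => /orP [/eqP <-|/IHs]; first exact: geq_minl.
by apply: leq_trans; apply: geq_minr.
Qed.

Lemma longest_seq (V : finType) (P : pred (seq V)) s0 : P s0 -> (forall s, P s -> uniq s) ->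
  exists2 s, P s & forall s', P s' -> size s' <= size s.
Proof.
move=> Ps0 Pu; pose Q m := [exists t : m.-tuple V, P t].
have PQ s : P s -> Q (size s).
  by move=> Ps; apply/existsP; exists (in_tuple s).
have exQ : exists m, Q m by exists (size s0); apply: PQ.
have Qle m : Q m -> m <= #|V|.
  case/existsP => t /Pu ut; rewrite -(size_tuple t).
  by have /card_uniqP <- := ut; apply: max_card.
case: (ex_maxnP exQ Qle) => m /existsP [t Pt] max; exists t => // s /PQ.
by rewrite size_tuple; apply: max.
Qed.

Section Circumference.
Variables (V : finType) (e : rel V) (d : nat).
Hypotheses (e_sym : symmetric e) (e_irr : irreflexive e).
Hypothesis deg_ge : forall x, d <= #|nbrs e x|.

(** All neighbours of the first vertex of a longest path lie on the path; one at index at least d -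
    1 of the remaining sequence closes the cycle. *)
Lemma long_cycle (x0 : V) : 1 < d -> exists c, [/\ cycle e c, uniq c & d < size c].
Proof.
move=> d1; pose P s := uniq s && sorted e s.
have [|s /andP [us ps] s_max] := @longest_seq V P [:: x0] isT; first by move=> s /andP [].
case: s us ps s_max => [|x q]; first by move=> _ _ /(_ [:: x0] isT).
move=> us ps s_max.
have xq z : e x z -> z \in q.
  move=> xz; apply: contraT => zq; have := s_max (z :: x :: q).
  rewrite /P /= in us ps *; rewrite us ps e_sym xz in_cons (negbTE zq) orbF /= !andbT.
  have -> : z != x by apply: contraTneq xz => ->; rewrite e_irr.
  by move/(_ isT); rewrite ltnn.
have [z xz zfar] : exists2 z, e x z & d.-1 <= index z q.
  have /subsetPn [z] : ~~ (nbrs e x \subset [set z in take d.-1 q]).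
    have le : #|[set z in take d.-1 q]| <= d.-1.
      by rewrite cardsE; apply: leq_trans (card_size _) _; rewrite size_take_min geq_minl.
    by apply/negP => /subset_leq_card; have := deg_ge x; nat_lia.
  rewrite in_nbrs in_set => xz; rewrite in_take ?xq // -leqNgt.
  by exists z.
have zq := xq z xz; case/splitPr: zq us ps zfar {xq s_max} => a b us ps.
have za : z \notin a.
  by move: us; rewrite cons_uniq cat_uniq => /and4P [_ _ /hasPn /(_ z) + _]; apply; rewrite inE eqxx.
rewrite index_cat (negbTE za) /= eqxx addn0 => le; exists (x :: rcons a z); split.
- rewrite /= rcons_path last_rcons e_sym xz andbT rcons_path.
  by move: ps; rewrite /= cat_path /= => /and3P [-> ->].
- move: us; rewrite -cat_rcons -cat_cons cat_uniq; by case/andP.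
- by rewrite /= size_rcons; nat_lia.
Qed.

Lemma cycle_le_circumference c : cycle e c -> uniq c -> 2 < size c -> size c <= circumference e.
Proof.
move=> cc uc c2; have cV : size c < #|V|.+1 by have /card_uniqP <- := uc; rewrite ltnS max_card.
have := @leq_bigmax_cond _ (fun k : 'I_#|V|.+1 => has_cycle_of_size e k) (fun k => nat_of_ord k) (Ordinal cV).
apply; apply/andP; split=> //; apply/existsP; exists (in_tuple c).
by rewrite /ucycleb cc.
Qed.

Lemma circumference_attained : 0 < circumference e ->
  exists c, [/\ cycle e c, uniq c & size c = circumference e].
Proof.
move=> pos; have [k] : {k : 'I_#|V|.+1 | has_cycle_of_size e k & circumference e = k}.
  apply: (@eq_bigmax_cond _ (fun k : 'I_#|V|.+1 => has_cycle_of_size e k) (fun k => nat_of_ord k)).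
  rewrite lt0n; apply: contraTneq pos => /card0_eq none.
  by rewrite /circumference big_pred0.
case/andP=> _ /existsP [c /andP [cc uc]] ->.
by exists c; rewrite size_tuple.
Qed.

Lemma longest_cycle_of_seq c : cycle e c -> uniq c -> 2 < size c ->
  (forall c', cycle e c' -> uniq c' -> size c' <= size c) -> exists g, longest_cycle e (size c) g.
Proof.
case: c => // x p cc uc c2 max; set N := size (x :: p).
have N0 : 0 < N by [].
exists (fun i => nth x (x :: p) (i %% N)); split=> //.
- move=> i; have lt : i %% N < size (rcons p x) by rewrite size_rcons ltn_mod.
  move: cc => /= /(pathP x) /(_ (i %% N) lt).
  rewrite -rcons_cons nth_rcons -/N ltn_mod N0 nth_rcons.
  have [lt' | ge] := ltnP (i %% N) (size p).
    have -> : i.+1 %% N = (i %% N).+1.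
      by rewrite -(addn1 i) -modnDml addn1 modn_small // ltnS.
    by [].
  have ei : i %% N = size p by apply/eqP; rewrite eqn_leq ge -ltnS ltn_mod N0.
  have -> : i.+1 %% N = 0 by rewrite -(addn1 i) -modnDml ei addn1 modnn.
  by rewrite ei eqxx.
- by move=> i; rewrite modnDr.
- by move=> i j iN jN /eqP; rewrite !modn_small // nth_uniq // => /eqP.
Qed.

End Circumference.

(** * Minimum degree one *)

Section DegreeOne.
Variables (V : finType) (e : rel V).
Hypotheses (e_sym : symmetric e) (e_conn : connected e).
Hypothesis deg_le1 : forall x, #|nbrs e x| <= 1.
Hypothesis deg_ge1 : forall x, 1 <= #|nbrs e x|.

Let arcs : {set V * V} := [set p | e p.1 p.2].

Let adj_arcs : adj arcs =2 e.
Proof. by move=> x y; rewrite /adj /= in_set. Qed.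

(** A cycle would need a vertex of degree 2, so the whole edge set is a spanning tree, and each
    vertex is a leaf of it. *)
Lemma matching_leaf_number : #|V| <= leaf_number e.
Proof.
have st : spanning_tree e arcs.
  apply/and4P; split.
  - by apply/forallP => x; apply/forallP => y; rewrite adj_arcs implybb.
  - by apply/forallP => x; apply/forallP => y; rewrite !adj_arcs e_sym.
  - apply/forallP => x; apply/forallP => y; rewrite (eq_connect adj_arcs).
    by move/forallP: e_conn => /(_ x) /forallP.
  apply/existsP => -[k /andP [k2 /existsP [c /andP [cyc uniq_c]]]].
  have := size_tuple c; case: (tval c) cyc uniq_c => [|x [|y s]]; try by move=> _ _ /= sz; rewrite -sz in k2.
  case/lastP: s => [|s z]; first by move=> _ _ /= sz; rewrite -sz in k2.
  rewrite /= rcons_path last_rcons !adj_arcs => /and3P [xy _ zx] /and3P [_ ynz _] _.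
  have := deg_le1 x; rewrite (cardsD1 y) (cardsD1 z) in_setD1 !in_nbrs xy e_sym zx andbT.
  suff -> : z != y by [].
  by apply: contraNneq ynz => <-; rewrite mem_rcons inE eqxx.
apply: leq_trans (leq_bigmax_cond _ st); rewrite -cardsT; apply/subset_leq_card/subsetP => x _.
rewrite in_set /degree.
have -> : [set y | adj arcs x y] = nbrs e x by apply/setP => y; rewrite !in_set adj_arcs.
by rewrite eqn_leq deg_le1 deg_ge1.
Qed.

End DegreeOne.

Theorem theorem11 (V : finType) (e : rel V)
  (e_sym : symmetric e) (e_irr : irreflexive e)
  (V_nontrivial : 1 < #|V|) (e_conn : connected e)
  (order_le : #|V| <= 3 * min_degree e)
  (leaf_le : leaf_number e <= 2 * min_degree e - 1) :
  #|V| - 1 <= circumference e.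
Proof.
move: order_le leaf_le; set d := min_degree e => order leaf.
have deg_ge x : d <= #|nbrs e x| by apply: min_degree_le.
clearbody d.
(* The subtraction in [leaf] does not truncate, since 1 < |V| <= 3 * d makes d positive. *)
have leafb S : conn_set e S -> #|bnd e S| < 2 * d.
  by move/(bnd_leaf_number e_sym e_conn); nat_lia.
have [d1|d_le1] := ltnP 1 d; last first.
  have d1 : d = 1 by nat_lia.
  suff : #|V| <= leaf_number e by nat_lia.
  apply: matching_leaf_number => // x; last by rewrite -d1.
  have : nbrs e x \subset bnd e [set x].
    apply/subsetP => z; rewrite in_nbrs => xz; apply: (@in_bnd _ _ _ x); rewrite ?set11 // in_set1.
    by apply: contraTneq xz => ->; rewrite e_irr.
  by move/subset_leq_card; have := leafb _ (conn_set1 e x); nat_lia.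
have [x0 _] : exists x0 : V, x0 \in V by apply/card_gt0P; apply: ltnW.
have [c0 [cc0 uc0 dc0]] := long_cycle e_sym e_irr deg_ge x0 d1.
(* This makes N > 2 and gives l < N for short off-cycle paths. *)
have dN : d < circumference e.
  exact: leq_trans dc0 (cycle_le_circumference cc0 uc0 (leq_ltn_trans d1 dc0)).
have [|c [cc uc sc]] := @circumference_attained _ e; first by nat_lia.
have c2 : 2 < size c by nat_lia.
have [|g cC] := longest_cycle_of_seq cc uc c2.
  move=> c' cc' uc'; rewrite sc; have [le|lt] := leqP (size c') 2; first by nat_lia.
  exact: cycle_le_circumference.
rewrite sc in cC; set N := circumference e in cC dN sc *.
rewrite leqNgt; apply/negP => lt.
pose C := cyc N g.
have [u uC] : exists u, u \in ~: C.
  by apply/set0Pn; rewrite -card_gt0; have := cardsC C; rewrite (card_cyc cC); nat_lia.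
rewrite in_setC in uC.
have [||s offs s_max] := @longest_seq V (off_path e N g) [:: u].
- by rewrite /off_path /off_cycle /= uC.
- by move=> s /off_path_uniq.
case: s offs s_max => [|x q] offq q_max.
  by have := q_max [:: u]; rewrite /off_path /off_cycle /= uC => /(_ isT).
have [q0|q0] := posnP (size q).
  (* A longest off-cycle path with a single vertex means that the complement of C is independent. *)
  apply: (dominating_cycle_contra e_sym e_irr cC (ltnW d1) deg_ge leafb) => //; last by nat_lia.
  move=> y z yC zC; apply/negP => yz; have := q_max [:: y; z].
  rewrite /off_path /off_cycle /= yz yC zC inE q0 !andbT.
  have -> : y != z by apply: contraTneq yz => ->; rewrite e_irr.
  by move/(_ isT).
have [long|short] := leqP d (size (x :: q)).
  exact: (long_off_path_contra e_sym e_irr cC offq e_conn d1 deg_ge leafb order long).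
have dE : (size q).+1 + (d - (size q).+1) = d by rewrite subnKC // ltnW.
apply: (@short_off_path_contra _ _ e_sym e_irr N g cC x q offq q_max (d - (size q).+1)); rewrite ?dE //.
- by rewrite subn_gt0.
- exact: ltn_trans short dN.
Qed.
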